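(* Let $n\ge 1$, $m\ge 0$ and $s$ be integers with $1\le s\le n$. Consider the hexagon $H$ in the triangular lattice (unit equilateral triangles, with one family of lattice lines vertical) whose sides have lengths $n,n,2m+1,n,n,2m+1$ in cyclic order, the two sides of length $2m+1$ being vertical. Let $L$ be the horizontal symmetry axis of $H$ (the line through the midpoints of the two vertical sides); $L$ contains exactly $n$ lattice vertices in the interior of $H$, numbered $1,\dots,n$ from left to right. Let $P$ be the $s$-th of these vertices, and remove from $H$ the two unit triangles that have $P$ as a vertex and are bisected by $L$ (one immediately to the left and one immediately to the right of $P$, touching only at $P$). Then the number of rhombus tilings of the resulting region equals $$\frac{(2m+1)\binom{2m}{m}\binom{2n-2s}{n-s}\binom{2s-2}{s-1}}{\binom{2m+2n}{m+n}}\prod_{i=1}^{n}\prod_{j=1}^{n}\prod_{k=1}^{2m+1}\frac{i+j+k-1}{i+j+k-2}.$$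
   Context: A rhombus tiling of a region made of unit triangles of the triangular lattice is a tiling of the region by unit rhombi, each rhombus being the union of two unit equilateral triangles sharing a side. *)

(* Defs.v *)
From mathcomp Require Import all_boot.
From mathcomp Require Import zify.

Set Implicit Arguments.
Unset Strict Implicit.
Unset Printing Implicit Defensive.

(* The pair (a, b) stands for the vertex a * (sqrt 3 / 2, 1 / 2) + b * (0, 1)
   of the triangular lattice: a numbers the vertical lattice lines from left to
   right, and the height of (a, b) is a / 2 + b. *)
Definition vertex : Type := (nat * nat)%type.

(* The unit triangles of the parallelogram [0, w] x [0, h]: the cell with lower
   left corner (a, b) is cut by the segment from (a, b + 1) to (a + 1, b) into a
   triangle pointing right (true) and one pointing left (false). *)
Definition triangle (w h : nat) : finType := ('I_w * 'I_h * bool)%type.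

Definition vertices w h (t : triangle w h) : seq vertex :=
  let: (a, b, points_right) := t in
  if points_right then [:: (a : nat, b : nat); (a : nat, b.+1); (a.+1, b : nat)]
  else [:: (a.+1, b : nat); (a.+1, b.+1); (a : nat, b.+1)].

Definition share_side w h (t u : triangle w h) : bool :=
  count [in vertices u] (vertices t) == 2.

Definition rhombus w h (B : {set triangle w h}) : bool :=
  [exists t, exists u, share_side t u && (B == [set t; u])].

Definition rhombus_tilings w h (R : {set triangle w h}) :
    {set {set {set triangle w h}}} :=
  [set T | partition T R & [forall B in T, rhombus B]].

(* The hexagon with corners (0, n), (0, n + c), (n, n + c), (2n, c), (2n, 0),
   (n, 0): its vertical sides have length c and its other sides length n. *)
Definition in_hexagon (n c : nat) (p : vertex) : bool :=
  [&& p.1 <= n.*2, p.2 <= n + c & n <= p.1 + p.2 <= n.*2 + c].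

Definition in_hexagon_interior (n c : nat) (p : vertex) : bool :=
  [&& 0 < p.1 < n.*2, 0 < p.2 < n + c & n < p.1 + p.2 < n.*2 + c].

(* The hexagon being convex, it contains a triangle as soon as it contains its
   three vertices. *)
Definition hexagon (n c : nat) : {set triangle n.*2 (n + c)} :=
  [set t | all (in_hexagon n c) (vertices t)].

(* The horizontal symmetry axis of the hexagon is at height n + c / 2. *)
Definition on_axis (n c : nat) (p : vertex) : bool :=
  p.1 + p.2.*2 == n.*2 + c.

(* The subtraction does not truncate on the vertices of the hexagon. *)
Definition reflection (n c : nat) (p : vertex) : vertex :=
  (p.1, n.*2 + c - (p.1 + p.2)).

(* A triangle having a vertex on the axis is bisected by the axis exactly when
   the reflection maps it to itself. *)
Definition bisected (n c : nat) w h (t : triangle w h) : bool :=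
  perm_eq [seq reflection n c p | p <- vertices t] (vertices t).

(* The s-th interior lattice vertex on the axis, counted from 1, when the
   vertical sides have length 2m + 1; see axis_vertexP. *)
Definition axis_vertex (n m s : nat) : vertex := (s.*2.-1, n + m.+1 - s).

Definition holey_hexagon (n m s : nat) :
    {set triangle n.*2 (n + m.*2.+1)} :=
  hexagon n m.*2.+1 :\:
    [set t | (axis_vertex n m s \in vertices t) && bisected n m.*2.+1 t].

Lemma axis_vertexP (n m : nat) (p : vertex) :
  reflect (exists2 s, 1 <= s <= n & p = axis_vertex n m s)
          (in_hexagon_interior n m.*2.+1 p && on_axis n m.*2.+1 p).
Proof.
case: p => a b; rewrite /in_hexagon_interior /on_axis /axis_vertex /=.
apply: (iffP idP) => [H | [s Hs [-> ->]]]; last by lia.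
by exists (a.+1./2); [lia | congr pair; lia].
Qed.

Lemma axis_vertex_left_to_right (n m s t : nat) :
  0 < s < t -> (axis_vertex n m s).1 < (axis_vertex n m t).1.
Proof. by rewrite /axis_vertex /=; lia. Qed.

Lemma bisected_at_axis_vertexP (n m s : nat)
    (t : triangle n.*2 (n + m.*2.+1)) :
  1 <= s <= n ->
  reflect (vertices t =
             [:: (s.*2.-2, n + m.+1 - s); (s.*2.-2, n + m.+2 - s);
                 axis_vertex n m s] \/
           vertices t =
             [:: (s.*2, n + m - s); (s.*2, n + m.+1 - s);
                 axis_vertex n m s])
          ((axis_vertex n m s \in vertices t) && bisected n m.*2.+1 t).
Proof.
move=> s_bounds; rewrite /bisected /axis_vertex; case: t => [[a b] r].
case: a b => [a lt_a] [b lt_b]; apply: (iffP idP) => [/andP[P_t /perm_mem fix_t]|].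
  case: r P_t fix_t => /= P_t fix_t.
    have := fix_t (reflection n m.*2.+1 (a.+1, b)).
    rewrite !inE eqxx !orbT /reflection !xpair_eqE /= => /esym.
    rewrite gtn_eqF //= eqxx /= => /eqP apex_fixed.
    left; move: P_t; rewrite !inE => /or3P[] /eqP[Ea Eb];
      by do !congr cons; congr pair; lia.
  have := fix_t (reflection n m.*2.+1 (a, b.+1)).
  rewrite !inE eqxx !orbT /reflection !xpair_eqE /= => /esym.
  rewrite ltn_eqF //= eqxx /= => /eqP apex_fixed.
  right; move: P_t; rewrite !inE => /or3P[] /eqP[Ea Eb];
    by do !congr cons; congr pair; lia.
have swap (x y z : vertex) : perm_eq [:: y; x; z] [:: x; y; z].
  by rewrite -(perm_catCA [:: x] [:: y] [:: z]).
case: r => -[] /= [*]; try lia; rewrite /reflection /=; apply/andP; split.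
- by rewrite !inE !xpair_eqE; lia.
- set y1 := _ - _; set y2 := _ - _; set y3 := _ - _.
  have [-> -> ->] : [/\ y1 = b.+1, y2 = b & y3 = b] by split; rewrite /y1 /y2 /y3; lia.
  exact: swap.
- by rewrite !inE !xpair_eqE; lia.
- set y1 := _ - _; set y2 := _ - _; set y3 := _ - _.
  have [-> -> ->] : [/\ y1 = b.+1, y2 = b & y3 = b.+1] by split; rewrite /y1 /y2 /y3; lia.
  exact: swap.
Qed.

(* Main.v *)
(* Sweep the strips between consecutive vertical lattice lines from left to
   right. The vertical edges that are not crossed by a rhombus form c = 2m + 1
   disjoint paths, which go up or down by half a unit in each strip; one of them
   ends at the left hole and restarts at the right hole. A determinant whose
   rows are indexed by the current ends of the paths obeys the same recursion
   as the number of tilings of what remains: it is additive in each row, and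
   colliding paths give equal rows. Hence the number of tilings is
   - det [M u; v 0], where M i j = 'C(2n, n + i - j), u i = 'C(2s - 2, s - 1 + i - m)
   and v j = 'C(2n - 2s, n - s + j - m), that is, det M * (x u) for x M = v.
   The Vandermonde determinant evaluates det M to MacMahon's product. By the
   symmetry of binomial coefficients, x is determined by weights p_k with
   sum_k p_k 'C(2(n+k+l), n+k+l) = 'C(2(n-s+l), n-s+l) for 0 <= l <= m, which are
   Lagrange interpolation coefficients, and x u = sum_k p_k 'C(2(k+s-1), k+s-1) is
   then a balanced 3F2 summed by the Pfaff-Saalschutz formula. *)

Require Import Defs.
From mathcomp Require Import all_boot all_order all_fingroup all_algebra qpoly.
From mathcomp Require Import zify ring lra.

Set Implicit Arguments.
Unset Strict Implicit.
Unset Printing Implicit Defensive.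

Import Order.TTheory GRing.Theory Num.Theory.

(** * Removing one rhombus *)

Section Peeling.
Variables w h : nat.
Implicit Types (t u : triangle w h) (R : {set triangle w h}).

Lemma vertices_uniq t : uniq (vertices t).
Proof.
case: t => [[a b] []]; rewrite /= !inE !xpair_eqE; lia.
Qed.

Lemma count_memC (T : eqType) (s1 s2 : seq T) :
  uniq s1 -> uniq s2 -> count [in s1] s2 = count [in s2] s1.
Proof.
move=> u1 u2; rewrite -!size_filter; apply: perm_size; apply: uniq_perm.
- exact: filter_uniq.
- exact: filter_uniq.
by move=> x; rewrite !mem_filter andbC.
Qed.

Lemma share_sideC t u : share_side t u = share_side u t.
Proof. by rewrite /share_side count_memC ?vertices_uniq. Qed.

Lemma share_side_irr t : share_side t t = false.
Proof.
rewrite /share_side (@eq_in_count _ _ predT) ?count_predT; last by move=> x /= ->.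
by case: t => [[a b] []].
Qed.

Lemma rhombus_tilings0 : #|rhombus_tilings (set0 : {set triangle w h})| = 1.
Proof.
rewrite (_ : rhombus_tilings _ = [set set0]) ?cards1 //.
apply/setP => T; rewrite !inE partition_set0.
by case: eqP => //= ->; apply/forall_inP => B; rewrite inE.
Qed.

Lemma rhombus_set2 t u : share_side t u -> rhombus [set t; u].
Proof.
by move=> tu; apply/existsP; exists t; apply/existsP; exists u; rewrite tu /=.
Qed.

Lemma rhombus_partner (B : {set triangle w h}) t :
  rhombus B -> t \in B -> exists2 u, share_side t u & B = [set t; u].
Proof.
case/existsP => x /existsP[y /andP[xy /eqP ->]].
rewrite !inE => /orP[] /eqP ->; first by exists y.
by exists x; rewrite 1?share_sideC // setUC.
Qed.

(** Adding the rhombus back is a bijection from the tilings of the rest, inverse to deleting it. It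
    is injective because the rhombus is nonempty and disjoint from the rest, hence lies in none of
    those tilings. *)
Lemma card_tilings_with_rhombus R t u :
  t \in R -> u \in R -> share_side t u ->
  #|[set T in rhombus_tilings R | [set t; u] \in T]| =
  #|rhombus_tilings (R :\: [set t; u])|.
Proof.
move=> tR uR tu; set B := [set t; u].
have BR : B \subset R by rewrite subUset !sub1set tR.
have B0 : B != set0 by apply/set0Pn; exists t; rewrite !inE eqxx.
have BRD : [disjoint B & R :\: B].
  by rewrite -setI_eq0 setIDA [B :&: R]setIC -setIDA setDv setI0.
have notin T : T \in rhombus_tilings (R :\: B) -> B \notin T.
  rewrite inE => /andP[pT _]; apply/negP => BT.
  have := partitionS pT BT; rewrite -setI_eq0 in BRD.
  by rewrite -(setIidPl (partitionS pT BT)) (eqP BRD) eqxx in B0.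
rewrite -(card_in_imset (f := fun T => B |: T) (D := mem (rhombus_tilings (R :\: B)))).
  apply: eq_card => T; rewrite !inE; apply/andP/imsetP.
  - case=> /andP[pT /forall_inP rT] BT; exists (T :\ B); last by rewrite setD1K.
    rewrite inE partitionD1 //=; apply/forall_inP => C; rewrite !inE.
    by case/andP=> _ /rT.
  - case=> T'; rewrite inE => /andP[pT /forall_inP rT] ->.
    rewrite setU11; split=> //; apply/andP; split.
      rewrite -[R](setID _ B) (setIidPr BR); exact: partitionU1.
    by apply/forall_inP => C; rewrite !inE => /orP[/eqP->|/rT //]; apply: rhombus_set2.
move=> T T' HT HT' /(congr1 (fun X => X :\ B)).
by rewrite !setU1K ?notin.
Qed.

(** Each tiling covers [t] by exactly one rhombus, so the pairs of a tiling and the partner of [t]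
    in it are counted in two ways. *)
Lemma card_tilings_peel R t : t \in R ->
  #|rhombus_tilings R| =
  \sum_(u in R | share_side t u) #|rhombus_tilings (R :\: [set t; u])|.
Proof.
move=> tR.
under eq_bigr => u /andP[uR tu].
  rewrite -(card_tilings_with_rhombus tR uR tu) -sum1dep_card.
  under eq_bigl => T do rewrite andbC.
  over.
rewrite /= (exchange_big_dep (mem (rhombus_tilings R))) /=; last first.
  by move=> u T _ /andP[].
rewrite -sum1_card; apply: eq_bigr => T TR.
have:= TR; rewrite inE => /andP[pT /forall_inP rT].
have tcov : t \in cover T by rewrite (cover_partition pT).
have [u tu Bu] := rhombus_partner (rT _ (pblock_mem tcov))
  (etrans (mem_pblock T t) tcov).
have BT : [set t; u] \in T by rewrite -Bu pblock_mem.
rewrite (big_pred1 u) // => v /=; apply/andP/eqP.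
- case=> /andP[vR tv] /andP[] vT _.
  have := def_pblock (partition_trivIset pT) vT (set21 _ _).
  rewrite Bu => /setP/(_ v); rewrite !inE eqxx orbT => /orP[] /eqP // vt.
  by rewrite vt share_side_irr in tv.
- move=> ->; rewrite tu BT; move: TR; rewrite inE => ->; split=> //; rewrite ?andbT.
  by rewrite (subsetP (partitionS pT BT)) ?set22.
Qed.

End Peeling.

(** * Regions given by coordinates, and the neighbours of a triangle *)

Section CoordinateRegions.
Variables w h : nat.

Definition region (P : nat -> nat -> bool -> bool) : {set triangle w h} :=
  [set t : triangle w h | P (t.1.1 : nat) (t.1.2 : nat) t.2].

Definition ntilings P := #|rhombus_tilings (region P)|.

Definition remove2 (P : nat -> nat -> bool -> bool) a b r a' b' r' x y q :=
  [&& P x y q, ~~ [&& x == a, y == b & q == r] & ~~ [&& x == a', y == b' & q == r']].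

Lemma eq_ntilings P Q :
  (forall a b r, a < w -> b < h -> P a b r = Q a b r) -> ntilings P = ntilings Q.
Proof.
move=> PQ; rewrite /ntilings; congr #|rhombus_tilings _|.
by apply/setP => -[[a b] r]; rewrite !inE /= PQ.
Qed.

(** The vertices of a cell are offset by 0 or 1, so these four cases decide every comparison of
    coordinates made by [share_side]. *)
Lemma eq_nat_cases (x y : nat) :
  [\/ [/\ x == y, (x == y.+1) = false & (x.+1 == y) = false],
      [/\ (x == y) = false, x == y.+1 & (x.+1 == y) = false],
      [/\ (x == y) = false, (x == y.+1) = false & x.+1 == y] |
      [/\ (x == y) = false, (x == y.+1) = false & (x.+1 == y) = false]].
Proof.
have [xy|xy|->] := ltngtP x y.
- have [E|E] := eqVneq x.+1 y; [apply: Or43|apply: Or44]; split; lia.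
- have [E|E] := eqVneq x y.+1; [apply: Or42|apply: Or44]; split; lia.
- by apply: Or41; split; lia.
Qed.

(** The three alternatives are the triangles across the upper slanted, the lower slanted and the
    vertical side. *)
Lemma share_side_right (a : 'I_w) (b : 'I_h) (u : triangle w h) :
  share_side (a, b, true) u =
  ~~ u.2 && [|| (a == u.1.1 :> nat) && (b == u.1.2 :> nat),
              (a == u.1.1 :> nat) && (b == u.1.2.+1 :> nat)
            | (a == u.1.1.+1 :> nat) && (b == u.1.2 :> nat)].
Proof.
case: u => [[x y] q]; rewrite /share_side.
case: (eq_nat_cases a x) => -[A0 A1 A2]; case: (eq_nat_cases b y) => -[B0 B1 B2];
  by case: q; rewrite /= !inE !xpair_eqE !eqSS ?A0 ?A1 ?A2 ?B0 ?B1 ?B2.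
Qed.

Lemma share_side_left (a : 'I_w) (b : 'I_h) (u : triangle w h) :
  share_side (a, b, false) u =
  u.2 && [|| (a == u.1.1 :> nat) && (b == u.1.2 :> nat),
              (a == u.1.1 :> nat) && (b.+1 == u.1.2 :> nat)
            | (a.+1 == u.1.1 :> nat) && (b == u.1.2 :> nat)].
Proof.
case: u => [[x y] q]; rewrite /share_side.
case: (eq_nat_cases a x) => -[A0 A1 A2]; case: (eq_nat_cases b y) => -[B0 B1 B2];
  by case: q; rewrite /= !inE !xpair_eqE !eqSS ?A0 ?A1 ?A2 ?B0 ?B1 ?B2.
Qed.

Lemma region_remove2 P (t u : triangle w h) :
  region P :\: [set t; u] =
  region (remove2 P t.1.1 t.1.2 t.2 u.1.1 u.1.2 u.2).
Proof.
apply/setP => x; rewrite !inE /remove2 negb_or [LHS]andbC.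
by case: x t u => [[a b] r] [[a1 b1] r1] [[a2 b2] r2]; rewrite /= !xpair_eqE -!val_eqE /= -!andbA.
Qed.

Lemma sum_at (Q : pred (triangle w h)) (F : triangle w h -> nat) a b r (C : bool) K :
  (C -> a < w /\ b < h) ->
  (forall u, Q u = [&& C, u.1.1 == a :> nat, u.1.2 == b :> nat & u.2 == r]) ->
  (forall u, Q u -> F u = K) ->
  \sum_(u | Q u) F u = if C then K else 0.
Proof.
move=> bnd QE FK; case: (boolP C) => HC; last first.
  by rewrite big_pred0 // => u; rewrite QE (negbTE HC).
have [aw bh] := bnd HC.
rewrite (big_pred1 (Ordinal aw, Ordinal bh, r)).
  by apply: FK; rewrite QE HC /= !eqxx.
by move=> [[x y] q]; rewrite QE HC /= !xpair_eqE -!val_eqE /= andbA.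
Qed.

Variable P : nat -> nat -> bool -> bool.
Hypothesis P_range : forall a b r, P a b r -> a < w /\ b < h.

(** With nothing left across the vertical side, the partner lies in the same strip, across one of
    the two slanted sides. *)
Lemma ntilings_peel_right a b :
  P a b true -> (forall a', a'.+1 = a -> ~~ P a' b false) ->
  ntilings P =
    (if P a b false then ntilings (remove2 P a b true a b false) else 0) +
    (if (0 < b) && P a b.-1 false
     then ntilings (remove2 P a b true a b.-1 false) else 0).
Proof.
move=> Pab Pleft; have [aw bh] := P_range Pab.
rewrite [LHS](@card_tilings_peel _ _ _ (Ordinal aw, Ordinal bh, true)); last by rewrite inE.
rewrite (bigID (fun u : triangle w h => u.1.2 == b :> nat)) /=; congr (_ + _).
- apply: (@sum_at _ _ a b false); first by move/P_range.
  + move=> [[x y] q]; rewrite share_side_right !inE /=.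
    case: q; rewrite ?andbF //=.
    apply/idP/idP.
      case/andP=> /andP[Pxy] /or3P[] /andP[/eqP/esym xa /eqP/esym yb] /eqP yb'.
      - by rewrite -xa -yb' Pxy !eqxx.
      - lia.
      - by case/negP: (Pleft _ xa); rewrite -yb'.
    by case/and4P => HP /eqP -> /eqP -> _; rewrite HP !eqxx.
  + move=> [[x y] q]; rewrite share_side_right !inE /=.
    case: q; rewrite ?andbF //=.
    case/andP=> /andP[Pxy] /or3P[] /andP[/eqP/esym xa /eqP/esym yb] /eqP yb'.
    * by rewrite region_remove2 /= xa yb.
    * lia.
    * by case/negP: (Pleft _ xa); rewrite -yb'.
- apply: (@sum_at _ _ a b.-1 false); first by case/andP=> _ /P_range.
  + move=> [[x y] q]; rewrite share_side_right !inE /=.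
    case: q; rewrite ?andbF //=.
    apply/idP/idP.
      case/andP=> /andP[Pxy] /or3P[] /andP[/eqP/esym xa /eqP/esym yb] /eqP yb'.
      - lia.
      - by rewrite -xa -yb /= Pxy !eqxx.
      - lia.
    case/and4P => /andP[b0 HP] /eqP -> /eqP -> _; rewrite HP /=; lia.
  + move=> [[x y] q]; rewrite share_side_right !inE /=.
    case: q; rewrite ?andbF //=.
    case/andP=> /andP[Pxy] /or3P[] /andP[/eqP/esym xa /eqP/esym yb] /eqP yb'.
    * lia.
    * by rewrite region_remove2 /= xa -yb.
    * lia.
Qed.

(** Both possible partners in the same strip are gone, so the rhombus across the vertical side is
    forced. *)
Lemma ntilings_peel_left a b :
  P a b false -> ~~ P a b true -> ~~ P a b.+1 true ->
  ntilings P =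
    if P a.+1 b true then ntilings (remove2 P a b false a.+1 b true) else 0.
Proof.
move=> Pab P1 P2; have [aw bh] := P_range Pab.
rewrite [LHS](@card_tilings_peel _ _ _ (Ordinal aw, Ordinal bh, false)); last by rewrite inE.
apply: (@sum_at _ _ a.+1 b true); first by move/P_range.
- move=> [[x y] q]; rewrite share_side_left !inE /=.
  case: q; rewrite ?andbF //=.
  apply/idP/idP.
    case/andP=> Pxy /or3P[] /andP[/eqP/esym xa /eqP/esym yb]; rewrite xa yb in Pxy *.
    - by rewrite Pxy in P1.
    - by rewrite Pxy in P2.
    - by rewrite Pxy !eqxx.
  by case/and4P => HP /eqP -> /eqP -> _; rewrite HP !eqxx !orbT.
- move=> [[x y] q]; rewrite share_side_left !inE /=.
  case: q; rewrite ?andbF //=.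
  case/andP=> Pxy /or3P[] /andP[/eqP/esym xa /eqP/esym yb]; rewrite region_remove2 /= xa yb in Pxy *.
  + by rewrite Pxy in P1.
  + by rewrite Pxy in P2.
  + by [].
Qed.

End CoordinateRegions.

(** * Sweeping the strips *)

Section Strips.
Variables (w h : nat) (H : nat -> nat -> bool -> bool).
Hypothesis H_range : forall a b r, H a b r -> a < w /\ b < h.

(* What is left to tile once the strips to the left of column a have been
   filled: X are the heights of the triangles of strip a pointing right that
   are still free, Y those of its triangles pointing left already covered. *)
Definition sweep a (X Y : pred nat) x y q :=
  H x y q && ((a < x) || (x == a) && (if q then X y else ~~ Y y)).

Lemma sweep_range a X Y x y q : sweep a X Y x y q -> x < w /\ y < h.
Proof. by case/andP => /H_range. Qed.

Lemma eq_sweep a (X X' Y Y' : pred nat) :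
  (forall b, H a b true -> X b = X' b) -> (forall b, H a b false -> Y b = Y' b) ->
  ntilings w h (sweep a X Y) = ntilings w h (sweep a X' Y').
Proof.
move=> XX YY; apply: eq_ntilings => x y q _ _; rewrite /sweep.
by case: (eqVneq x a) => [->|_] //; case: q; case: (boolP (H _ _ _)) => // Ha;
  rewrite ?(XX _ Ha) ?(YY _ Ha).
Qed.

(** The two terms are the two steps of a path from the vertical edge [(a, b)]: to [(a.+1, b)], half
    a unit up, or to [(a.+1, b.-1)], half a unit down. *)
Lemma sweep_step a (X Y : pred nat) b : H a b true -> X b ->
  ntilings w h (sweep a X Y) =
    (if H a b false && ~~ Y b
     then ntilings w h (sweep a (predD1 X b) (predU1 b Y)) else 0) +
    (if [&& 0 < b, H a b.-1 false & ~~ Y b.-1]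
     then ntilings w h (sweep a (predD1 X b) (predU1 b.-1 Y)) else 0).
Proof.
move=> Hab Xb; rewrite (@ntilings_peel_right _ _ _ (@sweep_range _ _ _) a b).
- rewrite /sweep ltnn eqxx /=; congr (_ + _).
  + case: ifP => // _; apply: eq_ntilings => x y q _ _.
    rewrite /remove2 /=; case: (ltngtP x a) => [//|//|->] /=; rewrite ?andbT //.
    by case: q; rewrite ?andbF ?andbT //= 1?negb_or -?andbA; do ?bool_congr; case: (_ == b).
  + case: ifP => // _; apply: eq_ntilings => x y q _ _.
    rewrite /remove2 /=; case: (ltngtP x a) => [//|//|->] /=; rewrite ?andbT //.
    by case: q; rewrite ?andbF ?andbT //= 1?negb_or -?andbA; do ?bool_congr; case: (_ == _).
- by rewrite /sweep Hab eqxx Xb orbT.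
- by move=> a' <-; rewrite /sweep; case: (H _ _ _) => //=; lia.
Qed.

(** The left-pointing triangles that remain in strip [a] are forced to pair across their vertical
    sides. The hypothesis says that their partners are exactly the right-pointing triangles of the
    next strip outside [Z]. *)
Lemma sweep_next a (Y Z : pred nat) :
  (forall b, H a b false && ~~ Y b = H a.+1 b true && ~~ Z b) ->
  ntilings w h (sweep a pred0 Y) = ntilings w h (sweep a.+1 Z pred0).
Proof.
move=> HYZ.
(* [Q j] is what is left once the forced rhombi at heights below [j] are removed. *)
pose Q j x y q := H x y q &&
  [|| a.+1 < x, (x == a.+1) && (q ==> (Z y || (j <= y)))
    | [&& x == a, ~~ q, ~~ Y y & j <= y]].
have Q0 : ntilings w h (sweep a pred0 Y) = ntilings w h (Q 0).
  apply: eq_ntilings => x y q _ _; rewrite /sweep /Q leq0n !orbT implybT !andbT.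
  by case: q; case: (Y y); case: (H x y _) => //=; lia.
have QS j : ntilings w h (Q j) = ntilings w h (Q j.+1).
  case: (boolP (H a j false && ~~ Y j)) => Hj; last first.
    have := HYZ j; rewrite (negbTE Hj) => /esym/negbT HZ.
    apply: eq_ntilings => x y q _ _; rewrite /Q.
    case: (eqVneq y j) => [->|yj]; last first.
      by rewrite (_ : (j < y) = (j <= y)) // [RHS]leq_eqVlt eq_sym (negbTE yj).
    rewrite ltnn leqnn orbF !andbT !andbF.
    case: (ltngtP x a.+1) => xa //=; rewrite ?orbF ?andbF ?andbT //.
    - case: (eqVneq x a) => [->|_]; case: q; rewrite /= ?andbF //.
      exact/negbTE.
    - rewrite xa; have -> : (a.+1 == a) = false by lia.
      rewrite orbT orbF /=; case: q => //=.
      by move: HZ; case: (H a.+1 j true) => //=; case: (Z j).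
  have := HYZ j; rewrite Hj => /esym/andP[H1 Z1]; case/andP: Hj => H0 Y0.
  rewrite (@ntilings_peel_left _ _ _ _ a j).
  - rewrite /Q H1 eqxx leqnn !orbT /=; apply: eq_ntilings => x y q _ _.
    rewrite /remove2 /Q.
    case: (eqVneq y j) => [->|yj]; last first.
      by rewrite /= !andbF !andbT (_ : (j < y) = (j <= y)) // [RHS]leq_eqVlt eq_sym (negbTE yj).
    rewrite ltnn leqnn orbF !andbT !andbF !orbT /= (negbTE Z1).
    case: q; rewrite /= ?andbF ?andbT ?orbF ?eqxx ?Y0 /=.
      by case: (H x j true) => //=; lia.
    by case: (H x j false) => //=; lia.
  - by move=> x y q /andP[/H_range].
  - by rewrite /Q H0 eqxx leqnn Y0 !orbT.
  - by rewrite /Q /= !andbF /= orbF; case: (H _ _ _) => //=; lia.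
  - by rewrite /Q /= !andbF /= orbF; case: (H _ _ _) => //=; lia.
have QE j : ntilings w h (sweep a pred0 Y) = ntilings w h (Q j).
  by elim: j => // j ->; apply: QS.
rewrite (QE h); apply: eq_ntilings => x y q _ yh; rewrite /sweep /Q.
rewrite [h <= y]leqNgt yh /= !andbF !orbF.
by case: q; case: (H x y _) => //=; case: (Z y); lia.
Qed.

Lemma sweep_blocked a (Y : pred nat) b :
  H a b false -> ~~ Y b -> ~~ H a.+1 b true ->
  ntilings w h (sweep a pred0 Y) = 0.
Proof.
move=> H0 Y0 H1.
rewrite (@ntilings_peel_left _ _ _ (@sweep_range _ _ _) a b).
- by rewrite /sweep (negbTE H1).
- by rewrite /sweep H0 eqxx Y0 orbT.
- by rewrite /sweep ltnn eqxx andbF.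
- by rewrite /sweep ltnn eqxx andbF.
Qed.

End Strips.

(** * Crossing one strip as a row-by-row expansion of a determinant *)

Section StripDeterminant.
Variables (w h : nat) (H : nat -> nat -> bool -> bool).
Hypothesis H_range : forall a b r, H a b r -> a < w /\ b < h.
Variables (c d : nat) (A : pred 'I_c).

Definition image_of (x : 'I_c -> nat) : pred nat := fun y => [exists i, A i && (x i == y)].

Definition increasing_on (x : 'I_c -> nat) : Prop :=
  forall i j : 'I_c, A i -> A j -> i < j -> x i < x j.

Local Open Scope ring_scope.

Definition set_row (i : 'I_c) (r : 'rV[rat]_d) (W : 'M[rat]_(c, d)) : 'M[rat]_(c, d) :=
  \matrix_(k, l) if k == i then r 0 l else W k l.

(** [Phi] stands for a determinant in the rows indexed by [A]. Its instances are [\det], [jump_det]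
    and [hole_det], one for each range of columns relative to the holes. *)
Variable Phi : 'M[rat]_(c, d) -> rat.
Hypothesis Phi_add : forall i W r r', A i ->
  Phi (set_row i (r + r') W) = Phi (set_row i r W) + Phi (set_row i r' W).
Hypothesis Phi_alt : forall i j W, A i -> A j -> i != j -> row i W = row j W -> Phi W = 0.
Hypothesis Phi_ext : forall W W', (forall i, A i -> row i W = row i W') -> Phi W = Phi W'.

Lemma Phi_row0 i W : A i -> row i W = 0 -> Phi W = 0.
Proof.
move=> Ai W0; have E : set_row i 0 W = W.
  apply/matrixP => k l; rewrite mxE; case: eqP => // ->.
  by move/rowP: W0 => /(_ l); rewrite !mxE.
have := @Phi_add i W 0 0 Ai; rewrite addr0 E => /eqP.
by rewrite -subr_eq subrr eq_sym => /eqP.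
Qed.

Variables (a : nat) (rho rho' : nat -> 'rV[rat]_d).
Hypothesis rho_step : forall b,
  rho b = rho' b + (if b is b'.+1 then rho' b' else 0).
(** A step to [b] that no rhombus can realise must contribute zero. *)
Hypothesis out_of_region : forall i W b, A i -> ~~ H a b false ->
  H a b true || H a b.+1 true -> row i W = rho' b -> Phi W = 0.

Let mixed k (x : 'I_c -> nat) : 'M[rat]_(c, d) :=
  \matrix_i (if (i < k)%N then rho' (x i) else rho (x i)).

(** The paths cross the strip one at a time, the lowest first. Additivity in row [i] gives the two
    steps of path [i]; a step out of the region contributes zero by [out_of_region], a step onto the
    previous path by [Phi_alt]. *)
Lemma strip_determinant (x : 'I_c -> nat) :
  increasing_on x -> (forall i, A i -> H a (x i) true) ->
  (forall y, increasing_on y -> (forall i, A i -> y i <= x i <= (y i).+1)%N ->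
     (forall i, A i -> H a (y i) false) ->
     (ntilings w h (sweep H a pred0 (image_of y)))%:R =
       Phi (\matrix_i rho' (y i))) ->
  (ntilings w h (sweep H a (image_of x) pred0))%:R = Phi (\matrix_i rho (x i)).
Proof.
(* In the intermediate states, [x i] is the new height of path [i] if [i < k] and its old height
   otherwise. [from] collects the triangles still free, [upto] those already covered. *)
pose from k (x : 'I_c -> nat) : pred nat :=
  fun y => [exists i : 'I_c, [&& A i, (k <= i)%N & x i == y]].
pose upto k (x : 'I_c -> nat) : pred nat :=
  fun y => [exists i : 'I_c, [&& A i, (i < k)%N & x i == y]].
suff main k : (k <= c)%N -> forall x, increasing_on x ->
    (forall i : 'I_c, A i -> (k <= i)%N -> H a (x i) true) ->
    (forall i : 'I_c, A i -> (i < k)%N -> H a (x i) false) ->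
    (forall y, increasing_on y ->
      (forall i : 'I_c, A i -> if (i < k)%N then y i = x i else (y i <= x i <= (y i).+1)%N) ->
      (forall i, A i -> H a (y i) false) ->
      (ntilings w h (sweep H a pred0 (image_of y)))%:R = Phi (\matrix_i rho' (y i))) ->
    (ntilings w h (sweep H a (from k x) (upto k x)))%:R = Phi (mixed k x).
  move=> incx xin Hend.
  rewrite (@eq_sweep _ _ _ _ _ (from 0 x) _ (upto 0 x)).
  - by rewrite main // => i Ai _; apply: xin.
  - by move=> b _; apply: eq_existsb => i.
  - by move=> b _; apply/esym/negbTE/existsP => -[i]; rewrite andbF.
move=> kc; rewrite -(subKn kc); elim: (c - k)%N (leq_subr k c) => [|n IH] nc {x} x incx xin xout Hend.
  rewrite subn0 in xin xout Hend *; rewrite (@eq_sweep _ _ _ _ _ pred0 _ (image_of x)).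
  - rewrite Hend // => [|i Ai|i Ai].
    + by congr Phi; apply/matrixP => i j; rewrite !mxE ltn_ord.
    + by rewrite ltn_ord.
    + by apply: xout.
  - by move=> b _; apply/negbTE/existsP => -[i] /and3P[_]; rewrite leqNgt ltn_ord.
  - by move=> b _; apply: eq_existsb => i; rewrite ltn_ord.
have En : (c - n = (c - n.+1).+1)%N by lia.
have {IH} := IH (ltnW nc); rewrite {}En.
have kc' : (c - n.+1 < c)%N by lia.
set l := (c - n.+1)%N in kc' xin xout Hend *; move=> IH.
pose i0 := Ordinal kc'.
have idx (i : 'I_c) : (i < l.+1)%N = (i == i0) || (i < l)%N.
  by rewrite ltnS leq_eqVlt -val_eqE.
have idx' (i : 'I_c) : (l <= i)%N = (i == i0) || (l < i)%N.
  by rewrite leq_eqVlt eq_sym -val_eqE.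
(* A row outside [A] belongs to no moving path, and [Phi] ignores it. *)
case: (boolP (A i0)) => Ai0; last first.
  rewrite (@eq_sweep _ _ _ _ _ (from l.+1 x) _ (upto l.+1 x)).
  - rewrite IH //.
    + apply: Phi_ext => i Ai; apply/rowP => j; rewrite !mxE idx.
      by case: eqP Ai => [->|//]; rewrite (negbTE Ai0).
    + by move=> i Ai li; apply: xin => //; apply: ltnW.
    + move=> i Ai; rewrite idx; case: (i =P i0) => [ii|_ /=]; last exact: xout.
      by rewrite ii (negbTE Ai0) in Ai.
    + move=> y incy xy yin; apply: Hend => // i Ai.
      have := xy i Ai; rewrite idx; case: (i =P i0) => // ii.
      by rewrite ii (negbTE Ai0) in Ai.
  - move=> b _; apply: eq_existsb => i; case: (boolP (A i)) => //= Ai.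
    by rewrite idx'; case: (i =P i0) => // ii; rewrite ii (negbTE Ai0) in Ai.
  - move=> b _; apply: eq_existsb => i; case: (boolP (A i)) => //= Ai.
    by rewrite idx; case: (i =P i0) => // ii; rewrite ii (negbTE Ai0) in Ai.
pose upd v (i : 'I_c) := if i == i0 then v else x i.
set b := x i0.
have Hb : H a b true by apply: xin.
have Xb : from l x b by apply/existsP; exists i0; rewrite Ai0 leqnn eqxx.
have lti0 (i : 'I_c) : A i -> (i < l)%N -> (x i < b)%N by move=> Ai il; apply: incx.
have gti0 (i : 'I_c) : A i -> (l < i)%N -> (b < x i)%N by move=> Ai il; apply: incx.
have fromE v y : H a y true -> predD1 (from l x) b y = from l.+1 (upd v) y.
  move=> _ /=; apply/andP/existsP => [[yb /existsP[i /and3P[Ai li /eqP xi]]]|[i]].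
    exists i; rewrite Ai /upd; case: (i =P i0) => [ii|/eqP ii].
      by rewrite -xi ii eqxx in yb.
    by rewrite xi eqxx andbT /= ltn_neqAle li andbT eq_sym.
  rewrite /upd; case: (i =P i0) => [->|/eqP ii] /and3P[Ai li /eqP xi]; first by rewrite ltnn in li.
  split; last by apply/existsP; exists i; rewrite Ai xi eqxx (ltnW li).
  by rewrite -xi eq_sym neq_ltn gti0.
have uptoE v y : H a y false -> predU1 v (upto l x) y = upto l.+1 (upd v) y.
  move=> _ /=; apply/orP/existsP => [[/eqP ->|/existsP[i /and3P[Ai li /eqP xi]]]|[i]].
  - by exists i0; rewrite Ai0 /= ltnS leqnn /upd !eqxx.
  - exists i; rewrite Ai /upd; case: (i =P i0) => [ii|_]; first by rewrite ii ltnn in li.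
    by rewrite xi eqxx ltnW.
  - rewrite /upd idx; case: (i =P i0) => [_|_] /and3P[Ai li /eqP xi]; first by left; rewrite xi.
    by right; apply/existsP; exists i; rewrite Ai xi eqxx andbT.
have step v : (v <= b <= v.+1)%N -> H a v false -> ~~ upto l x v ->
    (ntilings w h (sweep H a (predD1 (from l x) b) (predU1 v (upto l x))))%:R
    = Phi (set_row i0 (rho' v) (mixed l x)).
  move=> vb Hv nv.
  rewrite (eq_sweep _ _ (fromE v) (uptoE v)) IH.
  - congr Phi; apply/matrixP => i j; rewrite !mxE /upd idx.
    by case: eqP => // ->; rewrite eqxx.
  - move=> i j Ai Aj ij; rewrite /upd; case: (i =P i0) => [ii|_]; case: (j =P i0) => [jj|_].
    + by rewrite ii jj ltnn in ij.
    + by rewrite ii in ij; apply: leq_ltn_trans (gti0 _ Aj ij); case/andP: vb.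
    + rewrite jj in ij; have := lti0 _ Ai ij.
      (* An earlier path is at height at most [v], and [v] is not yet covered. *)
      have : x i != v; last by move: vb; lia.
      apply: contra nv => /eqP xv; apply/existsP; exists i.
      by rewrite Ai xv eqxx ij.
    + exact: incx.
  - move=> i Ai li; rewrite /upd; case: (i =P i0) => [ii|_]; first by rewrite ii ltnn in li.
    by apply: xin => //; apply: ltnW.
  - move=> i Ai; rewrite idx /upd; case: (i =P i0) => [ii|_] //= li; exact: xout.
  - move=> y incy xy yin; apply: Hend => // i Ai.
    have := xy i Ai; rewrite idx /upd; case: (i =P i0) => // -> /= ->.
    by rewrite ltnn.
rewrite (sweep_step H_range _ Hb Xb) natrD.
have -> : mixed l x = set_row i0 (rho b) (mixed l x).
  apply/matrixP => i j; rewrite !mxE; case: eqP => // ->.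
  by rewrite ltnn.
rewrite rho_step Phi_add //; congr (_ + _).
(* A step up cannot collide, since the earlier paths are strictly below [b]. *)
- have -> : ~~ upto l x b.
    by apply/existsP => -[i /and3P[Ai il]]; rewrite ltn_eqF // lti0.
  rewrite andbT; case: ifP => [Hv|/negbT Hv].
    by rewrite step ?leqnn ?leqnSn //; apply/existsP => -[i /and3P[Ai il]]; rewrite ltn_eqF // lti0.
  rewrite (@out_of_region i0 _ b) ?Hb //.
  by apply/rowP => j; rewrite !mxE eqxx.
(* From height 0 there is no step down. Otherwise an earlier path already at [b'] gives two equal
   rows. *)
- clearbody b; case: b Hb Xb lti0 gti0 fromE step => [|b'] Hb Xb lti0 gti0 fromE step /=.
    by rewrite (@Phi_row0 i0) //; apply/rowP => j; rewrite !mxE eqxx.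
  case: (boolP (H a b' false)) => [Hv|Hv] /=; last first.
    rewrite (@out_of_region i0 _ b') ?Hb ?orbT //.
    by apply/rowP => j; rewrite !mxE eqxx.
  case: ifP => [nv|/negbFE/existsP[i /and3P[Ai il /eqP xi]]].
    by rewrite step ?leqnSn ?leqnn.
  rewrite (@Phi_alt i i0) //; first by rewrite -val_eqE /= ltn_eqF.
  apply/rowP => j; rewrite !mxE eqxx -xi il.
  by rewrite -val_eqE /= ltn_eqF.
Qed.

End StripDeterminant.

(** * Path counts as coefficients of polynomials *)

Section StepCounts.
Local Open Scope ring_scope.

(* The number of ways to get from the vertical edge with lower end (a, b) to the
   one with lower end (a + D, j): each step keeps b or lowers it by one. *)
Definition npaths (D j b : nat) : rat := ((1 + 'X) ^+ D * 'X^j)`_b.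

Lemma npaths_step D j b :
  npaths D.+1 j b = npaths D j b + (if b is b'.+1 then npaths D j b' else 0).
Proof.
by rewrite /npaths exprS -mulrA mulrDl mul1r coefD coefXM; case: b.
Qed.

Lemma npaths0 j b : npaths 0 j b = (b == j)%:R.
Proof. by rewrite /npaths expr0 mul1r coefXn. Qed.

Lemma size_exp1X D : size ((1 + 'X) ^+ D : {poly rat}) = D.+1.
Proof. by rewrite addrC -[1]opprK -polyC1 -polyCN size_exp_XsubC. Qed.

Lemma npaths_out D j b : (D + j < b)%N -> npaths D j b = 0.
Proof.
move=> lt_b; rewrite /npaths nth_default //.
by rewrite size_mulXn ?size_exp1X ?addnS 1?addnC // -size_poly_eq0 size_exp1X.
Qed.

Lemma det_add_row k (M M1 M2 : 'M[rat]_k) i :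
  (forall j, M i j = M1 i j + M2 i j) ->
  (forall l j, l != i -> M l j = M1 l j /\ M l j = M2 l j) ->
  \det M = \det M1 + \det M2.
Proof.
move=> Mi Ml; rewrite (@determinant_multilinear _ _ M M1 M2 i 1 1) ?mul1r //.
- by apply/rowP => j; rewrite !mxE !mul1r Mi.
- by apply/matrixP => l j; rewrite !mxE; case: (Ml (lift i l) j); rewrite // eq_sym neq_lift.
- by apply/matrixP => l j; rewrite !mxE; case: (Ml (lift i l) j); rewrite // eq_sym neq_lift.
Qed.

End StepCounts.

(** * The hexagon with two holes *)

Section HoleyHexagon.
Variables n m s : nat.
Hypothesis s_bounds : 1 <= s <= n.
Local Notation c := m.*2.+1.
Local Notation W := n.*2.
Local Notation h := (n + c).
(* The holes lie right of the vertical edge (2s - 2, f + 1) and left of (2s, f). *)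
Local Notation f := (n + m - s).

Definition edge a b := [&& a <= n.*2, b < n + c, n <= a + b & a + b < n.*2 + c].

(** A triangle is located by the lower end of its vertical side: [(a, b)] if it points right,
    [(a.+1, b)] if it points left. The excluded pairs are the vertical sides of the two holes. *)
Definition hol a b (q : bool) :=
  if q then [&& edge a b, a < n.*2 & (a, b) != (s.*2.-2, f.+1)]
  else [&& edge a.+1 b & (a.+1, b) != (s.*2, f)].

Lemma hol_range a b q : hol a b q -> a < n.*2 /\ b < n + c.
Proof. by case: q; rewrite /hol /edge; case: (_ != _) => /=; lia. Qed.

Lemma holey_hexagonE : holey_hexagon n m s = region n.*2 (n + c) hol.
Proof.
apply/setP => t; rewrite !inE.
have -> : (axis_vertex n m s \in vertices t) && bisected n c t =
   if t.2 then (t.1.1 == s.*2.-2 :> nat) && (t.1.2 == f.+1 :> nat)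
   else (t.1.1.+1 == s.*2 :> nat) && (t.1.2 == f :> nat).
  apply/(sameP (bisected_at_axis_vertexP t s_bounds)).
  rewrite /axis_vertex; case: t => [[[a aw] [b bh]] q] /=.
  apply: (iffP idP).
    by case: q => /andP[/eqP Ea /eqP Eb]; [left|right]; do !congr cons; congr pair; lia.
  by case: q => /= -[] [*]; lia.
case: t => [[[a aw] [b bh]] q] /=; rewrite /hol /edge /in_hexagon /=.
case: q => /=; rewrite !xpair_eqE; case: (_ && (b == _)) => /=; lia.
Qed.

Lemma hol_right a b : (a, b) != (s.*2.-2, f.+1) -> a < n.*2 -> hol a b true = edge a b.
Proof. by move=> ab an; rewrite /hol ab an /= andbT. Qed.

Lemma hol_edge a b : hol a b true -> edge a b.
Proof. by case/and3P. Qed.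

Lemma hol_left a b : (a.+1, b) != (s.*2, f) -> hol a b false = edge a.+1 b.
Proof. by move=> ab; rewrite /hol ab /= andbT. Qed.

Lemma hol_left_edge a b : hol a b false -> edge a.+1 b.
Proof. by case/andP. Qed.

Local Open Scope ring_scope.

Definition rho a b : 'rV[rat]_c := \row_j npaths (n.*2 - a) j b.

Lemma rho_step a b : (a < n.*2)%N ->
  rho a b = rho a.+1 b + (if b is b'.+1 then rho a.+1 b' else 0).
Proof.
move=> an; apply/rowP => j; rewrite !mxE (_ : n.*2 - a = (n.*2 - a.+1).+1)%N; last by lia.
by rewrite npaths_step; case: b => [|b]; rewrite !mxE.
Qed.

(** Such a step can only cross the upper right side, and from there even steps that all lower [b]
    end above the final edges [j < c]. *)
Lemma rho_out a b : (a < n.*2)%N -> ~~ edge a.+1 b -> edge a b || edge a b.+1 ->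
  rho a.+1 b = 0.
Proof.
move=> an; rewrite /edge => out near; apply/rowP => j; rewrite !mxE npaths_out //.
have := ltn_ord j; move: out near; lia.
Qed.

Lemma increasing_full k (x : 'I_k -> nat) :
  increasing_on predT x -> (forall i, x i < k)%N -> forall i, x i = i.
Proof.
move=> incx xk.
have ge l : forall i : 'I_k, (i : nat) = l -> (l <= x i)%N.
  elim: l => // l IH i il.
  have lk : (l < k)%N by rewrite ltnW // -il.
  have := IH (Ordinal lk) erefl; move/leq_ltn_trans; apply.
  by apply: incx; rewrite //= il.
have le l : forall i : 'I_k, (k - i = l.+1)%N -> (x i + l < k)%N.
  elim: l => [|l IH] i il; first by rewrite addn0.
  have lk : (i.+1 < k)%N by have := ltn_ord i; lia.
  have := IH (Ordinal lk); rewrite /= => /(_ ltac:(lia)).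
  by have := incx i (Ordinal lk) erefl erefl (leqnn _); lia.
move=> i; apply/eqP; rewrite eqn_leq (ge i) // andbT.
by have := le (k - i).-1 i; have := ltn_ord i; lia.
Qed.

(** The [c] disjoint paths fill the [c] edges of the right vertical side, so no triangle of the last
    strip waits for a partner beyond it. *)
Lemma full_column (x : 'I_c -> nat) b :
  increasing_on predT x -> (forall i, edge n.*2 (x i)) -> edge n.*2 b ->
  image_of predT x b.
Proof.
move=> incx xin; rewrite /edge => hb.
have bc : (b < c)%N by move: hb; lia.
apply/existsP; exists (Ordinal bc); rewrite /= (increasing_full incx) // => i.
by have := xin i; rewrite /edge; lia.
Qed.

(** Induction from the last column backwards: there the region is empty and the matrix is the
    identity. *)
Lemma sweep_det_right a (x : 'I_c -> nat) :
  (s.*2 <= a <= n.*2)%N -> increasing_on predT x -> (forall i, edge a (x i)) ->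
  (ntilings n.*2 h (sweep hol a (image_of predT x) pred0))%:R =
    \det (\matrix_i rho a (x i)).
Proof.
case/andP => sa an; rewrite -(subKn an) in sa *.
elim: (n.*2 - a)%N (leq_subr a n.*2) sa x => [|k IH] ka sa x incx xin.
  rewrite subn0 in xin *.
  have xE : forall i, x i = i.
    by apply: increasing_full => // i; have := xin i; rewrite /edge; lia.
  rewrite [X in \det X](_ : _ = 1%:M) ?det1; last first.
    by apply/matrixP => i j; rewrite !mxE subnn npaths0 xE.
  rewrite /ntilings (_ : region _ _ _ = set0) ?rhombus_tilings0 //.
  apply/setP => -[[u v] q]; rewrite !inE /sweep /= [_ == _]ltn_eqF ?ltn_ord //.
  by rewrite ltnNge ltnW ?ltn_ord // andbF.
have Ek : (n.*2 - k = (n.*2 - k.+1).+1)%N by lia.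
have {IH} := IH (ltnW ka); rewrite {}Ek.
set l := (n.*2 - k.+1)%N in sa xin * => IH.
have ln : (l < n.*2)%N by rewrite /l; lia.
apply: (@strip_determinant _ _ _ hol_range _ _ _ _ _ _ _ _ _ (rho l.+1)) => //.
- move=> i M r r' _; apply: (@det_add_row _ _ _ _ i) => [j|k' j /negbTE ki].
    by rewrite !mxE eqxx.
  by rewrite !mxE ki.
- move=> i j M _ _ ij Mij; apply: (determinant_alternate ij) => k'.
  by move/rowP: Mij => /(_ k'); rewrite !mxE.
- move=> M M' MM; congr (\det _); apply/row_matrixP => i; exact: MM.
- by move=> b; apply: rho_step.
- move=> i M b _ out near Mi.
  rewrite (expand_det_row _ i) big1 // => j _.
  have -> : M i j = row i M 0 j by rewrite mxE.
  rewrite {}Mi rho_out ?mxE ?mul0r //.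
    by rewrite -hol_left // xpair_eqE; move: sa; lia.
  by move: near; case/orP => /hol_edge ->; rewrite ?orbT.
- move=> i _; rewrite hol_right //; rewrite xpair_eqE; move: sa; lia.
- move=> y incy _ yin; rewrite -IH //; last first.
  + by move=> i; apply: hol_left_edge; apply: yin.
  + by apply: leqW.
  congr _%:R; apply: sweep_next; first exact: hol_range.
  move=> b; rewrite hol_left; last by rewrite xpair_eqE; move: sa; lia.
  case: (ltngtP l.+1 n.*2) => [lt|gt|eq]; last 1 first.
  + rewrite /hol eq ltnn andbF /= andbC; apply/negbTE; rewrite negb_and negbK.
    case: (boolP (edge _ b)) => //= eb; rewrite ?orbT // orbF.
    apply: full_column => // i; rewrite -eq; exact/hol_left_edge/yin.
  + by rewrite hol_right // xpair_eqE; move: sa; lia.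
  + by move: ln gt; lia.
Qed.

Section Jump.
(* The path i0 ends at the left hole and starts again from the right one. *)
Variable i0 : 'I_c.
Local Notation others := [pred i | i != i0].

(** Row [i0] is frozen at its start from the right hole while the other paths cross the two strips
    that contain the holes. *)
Definition jump_det (M : 'M[rat]_c) := \det (set_row i0 (rho s.*2 f) M).

Lemma jump_det_add i M r r' : others i ->
  jump_det (set_row i (r + r') M) =
  jump_det (set_row i r M) + jump_det (set_row i r' M).
Proof.
move=> /= ii; apply: (@det_add_row _ _ _ _ i) => [j|k' j /negbTE ki].
  by rewrite !mxE (negbTE ii) eqxx.
by rewrite !mxE ki.
Qed.

Lemma jump_det_alt i j M : others i -> others j -> i != j -> row i M = row j M ->
  jump_det M = 0.
Proof.
move=> /= ii jj ij Mij; apply: (determinant_alternate ij) => k'.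
by rewrite !mxE (negbTE ii) (negbTE jj); move/rowP: Mij => /(_ k'); rewrite !mxE.
Qed.

Lemma jump_det_ext M M' : (forall i, others i -> row i M = row i M') ->
  jump_det M = jump_det M'.
Proof.
move=> MM; congr (\det _); apply/matrixP => i j; rewrite !mxE.
by case: (eqVneq i i0) => // /MM /rowP/(_ j); rewrite !mxE.
Qed.

Lemma jump_det_out a i M b : (a < s.*2)%N -> others i -> ~~ hol a b false ->
  hol a b true || hol a b.+1 true -> row i M = rho a.+1 b -> jump_det M = 0.
Proof.
move=> la /= ii out near Mi.
case: (boolP ((a.+1, b) == (s.*2, f))) => [|nf].
  rewrite xpair_eqE => /andP[/eqP Ea /eqP Eb]; rewrite Ea Eb in Mi.
  apply: (determinant_alternate ii) => k'.
  rewrite !mxE (negbTE ii) eqxx.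
  by move/rowP: Mi => /(_ k'); rewrite !mxE.
rewrite /jump_det (expand_det_row _ i) big1 // => j _.
rewrite mxE (negbTE ii); have -> : M i j = row i M 0 j by rewrite mxE.
rewrite {}Mi rho_out ?mxE ?mul0r //; first by move: la s_bounds; lia.
  by rewrite -hol_left.
by move: near; case/orP => /hol_edge ->; rewrite ?orbT.
Qed.

Lemma sweep_det_middle (x : 'I_c -> nat) :
  increasing_on others x ->
  (forall i, others i -> edge s.*2.-1 (x i)) ->
  (forall i : 'I_c, i < i0 -> x i <= f)%N ->
  (forall i : 'I_c, i0 < i -> f < x i)%N ->
  (ntilings n.*2 h (sweep hol s.*2.-1 (image_of others x) pred0))%:R =
    jump_det (\matrix_i rho s.*2.-1 (x i)).
Proof.
move=> incx xin xlt xgt.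
have Es : (s.*2.-1.+1 = s.*2)%N by move: s_bounds; lia.
have sn : (s.*2 <= n.*2)%N by move: s_bounds; lia.
apply: (@strip_determinant _ _ _ hol_range _ _ _ _
  jump_det_add jump_det_alt jump_det_ext _ _ (rho s.*2)) => //.
- by move=> b; rewrite rho_step Es.
- move=> i M b ii out near; have := @jump_det_out s.*2.-1 i M b; rewrite Es; apply=> //.
- by move=> i ii; rewrite hol_right ?xin // ?xpair_eqE; move: s_bounds; lia.
move=> y incy xy yin.
(* Restarting path [i0] at [f] keeps the order: the other paths avoid the hole, and the bounds on
   [x] keep each on its own side of it. *)
pose z i := if i == i0 then f else y i.
have yf i : others i -> y i != f.
  move=> /= ii; have := yin i ii; rewrite /hol Es => /andP[_].
  by rewrite xpair_eqE eqxx.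
have incz : increasing_on predT z.
  move=> i j _ _ ij; rewrite /z.
  case: (eqVneq i i0) => ii; case: (eqVneq j i0) => jj.
  - by rewrite ii jj ltnn in ij.
  - have := xgt j; rewrite -ii => /(_ ij); have := xy j jj; have := yf j jj; lia.
  - have := xlt i; rewrite -jj => /(_ ij); have := xy i ii; have := yf i ii; lia.
  - exact: incy.
have zin i : edge s.*2 (z i).
  rewrite /z; case: (eqVneq i i0) => ii; last by rewrite -Es; apply/hol_left_edge/yin.
  by rewrite /edge; move: s_bounds; lia.
transitivity (\det (\matrix_i rho s.*2 (z i))); last first.
  congr (\det _); apply/matrixP => i j; rewrite !mxE /z.
  by case: eqP.
rewrite -sweep_det_right ?leqnn //.
congr _%:R; rewrite -[in RHS]Es; apply: sweep_next; first exact: hol_range.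
move=> b; rewrite Es /hol Es.
have zE : image_of predT z b = (b == f) || image_of others y b.
  apply/existsP/orP => [[i /= /eqP <-]|[/eqP ->|/existsP[i /andP[ii yb]]]].
  - rewrite /z; case: (eqVneq i i0) => ii; [left|right] => //.
    by apply/existsP; exists i; rewrite /= ii eqxx.
  - by exists i0; rewrite /z /= !eqxx.
  - by exists i; rewrite /z (negbTE ii).
rewrite zE !xpair_eqE eqxx (_ : (s.*2 == s.*2.-2)%N = false); last by move: s_bounds; lia.
rewrite /= !andbT negb_or -andbA.
case: (boolP (edge _ b)) => //= eb.
case: (ltngtP s.*2 n.*2) sn => //= eq _.
rewrite -negb_or -zE; apply/negbTE; rewrite negbK.
by apply: full_column => //; rewrite -eq.
Qed.

(** The right-pointing triangle at height [f.+1] is the left hole, so path [i0] stops there and only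
    the others cross the strip. *)
Lemma sweep_det_jump (x : 'I_c -> nat) :
  increasing_on predT x -> (forall i, edge s.*2.-2 (x i)) -> x i0 = f.+1 ->
  (ntilings n.*2 h (sweep hol s.*2.-2 (image_of predT x) pred0))%:R =
    jump_det (\matrix_i rho s.*2.-2 (x i)).
Proof.
move=> incx xin x0.
have Es : (s.*2.-2.+1 = s.*2.-1)%N by move: s_bounds; lia.
have sn : (s.*2.-1 < n.*2)%N by move: s_bounds; lia.
rewrite (@eq_sweep _ _ _ _ _ (image_of others x) _ pred0) //; last first.
  move=> b; rewrite /hol => /and3P[_ _]; rewrite xpair_eqE eqxx /= => bf.
  apply: eq_existsb => i /=; case: (eqVneq i i0) => // ->.
  by rewrite x0 eq_sym (negbTE bf).
apply: (@strip_determinant _ _ _ hol_range _ _ _ _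
  jump_det_add jump_det_alt jump_det_ext _ _ (rho s.*2.-1)) => //.
- by move=> b; rewrite rho_step Es // ltnW // -Es.
- move=> i M b ii out near; have := @jump_det_out s.*2.-2 i M b; rewrite Es; apply=> //.
  by move: s_bounds; lia.
- by move=> i j _ _; apply: incx.
- move=> i ii; rewrite hol_right ?xin //; last by move: s_bounds; lia.
  rewrite xpair_eqE eqxx /= -x0; case: (ltngtP i i0) => [lt|gt|/val_inj E].
  + by rewrite ltn_eqF // incx.
  + by rewrite gtn_eqF // incx.
  + by rewrite /= E eqxx in ii.
move=> y incy xy yin; rewrite -sweep_det_middle //.
- congr _%:R; rewrite -[in RHS]Es; apply: sweep_next; first exact: hol_range.
  move=> b; rewrite hol_left ?hol_right ?Es // xpair_eqE; move: s_bounds; lia.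
- by move=> i ii; rewrite -Es; apply/hol_left_edge/yin.
- move=> i ii; have := incx i i0 erefl erefl ii; rewrite x0.
  by have := xy i; rewrite /= neq_ltn ii => /(_ erefl); lia.
- move=> i ii; have := incx i0 i erefl erefl ii; rewrite x0.
  by have := xy i; rewrite /= neq_ltn ii orbT => /(_ erefl); lia.
Qed.

End Jump.

(* The last column counts the ways to reach the left hole, and the last row of
   hole_det starts from the right hole. *)
Definition rho_ext a b : 'rV[rat]_(c + 1) :=
  row_mx (rho a b) (const_mx (npaths (s.*2.-2 - a) f.+1 b)).

Definition hole_det (M : 'M[rat]_(c, c + 1)) : rat :=
  - \det (col_mx M (row_mx (rho s.*2 f) 0)).

Lemma hole_det_add i M r r' : true ->
  hole_det (set_row i (r + r') M) =
  hole_det (set_row i r M) + hole_det (set_row i r' M).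
Proof.
move=> _; rewrite /hole_det -opprD; congr (- _).
apply: (@det_add_row _ _ _ _ (lshift 1 i)) => [j|k' j].
  by rewrite !col_mxEu !mxE eqxx.
case: (splitP k') => l kl; last first.
  by have -> : k' = rshift c l by [apply: val_inj]; rewrite !col_mxEd.
have -> : k' = lshift 1 l by apply: val_inj.
rewrite eq_lshift => /negbTE li.
by rewrite !col_mxEu !mxE li.
Qed.

Lemma hole_det_alt i j M : true -> true -> i != j -> row i M = row j M ->
  hole_det M = 0.
Proof.
move=> _ _ ij Mij; rewrite /hole_det (@determinant_alternate _ _ _ (lshift 1 i) (lshift 1 j)) ?oppr0 //.
by move=> k'; rewrite !col_mxEu; move/rowP: Mij => /(_ k'); rewrite !mxE.
Qed.

Lemma hole_det_ext M M' : (forall i, true -> row i M = row i M') ->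
  hole_det M = hole_det M'.
Proof.
by move=> MM; congr hole_det; apply/row_matrixP => i; apply: MM.
Qed.

Lemma rho_ext_step a b : (a < s.*2.-2)%N ->
  rho_ext a b = rho_ext a.+1 b + (if b is b'.+1 then rho_ext a.+1 b' else 0).
Proof.
move=> la; rewrite /rho_ext rho_step; last by move: s_bounds; lia.
rewrite (_ : s.*2.-2 - a = (s.*2.-2 - a.+1).+1)%N; last by lia.
rewrite npaths_step; case: b => [|b]; rewrite ?addr0 // add_row_mx; congr row_mx.
by apply/matrixP => i j; rewrite !mxE.
Qed.

Lemma rho_ext_out a b : (a < s.*2.-2)%N -> ~~ edge a.+1 b ->
  edge a b || edge a b.+1 -> rho_ext a.+1 b = 0.
Proof.
move=> la out near; rewrite /rho_ext rho_out //; last by move: s_bounds; lia.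
rewrite npaths_out -?row_mx0 //.
by move: out near s_bounds; rewrite /edge; lia.
Qed.

(** The border column is the unit vector at [i0], the only path at the left hole. Exchanging row
    [i0] with the last row gives a block triangular matrix, and the sign of the exchange cancels the
    one in [hole_det]. *)
Lemma hole_det_jump (x : 'I_c -> nat) i0 :
  increasing_on predT x -> x i0 = f.+1 ->
  hole_det (\matrix_i rho_ext s.*2.-2 (x i)) =
  jump_det i0 (\matrix_i rho s.*2.-2 (x i)).
Proof.
move=> incx x0; rewrite /hole_det; set M := col_mx _ _.
have xi i : (x i == f.+1) = (i == i0).
  rewrite -x0; case: (ltngtP i i0) => [lt|gt|/val_inj ->]; last by rewrite !eqxx.
    by rewrite -val_eqE /= !ltn_eqF ?incx.
  by rewrite -val_eqE /= !gtn_eqF ?incx.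
pose N : 'M[rat]_(c + 1) := block_mx
  (set_row i0 (rho s.*2 f) (\matrix_i rho s.*2.-2 (x i))) 0 (rho s.*2.-2 f.+1) 1%:M.
have -> : M = xrow (lshift 1 i0) (rshift c 0) N.
  apply/matrixP => k l; rewrite /xrow [RHS]mxE.
  case: (splitP k) => k' Ek; last first.
    have -> : k = rshift c 0 by apply: val_inj; rewrite /= Ek (ord1 k').
    rewrite tpermR /M /N /block_mx col_mxEd col_mxEu !mxE.
    by case: (split l) => l'; rewrite !mxE ?eqxx.
  have -> : k = lshift 1 k' by apply: val_inj.
  case: (eqVneq k' i0) => [->|ki].
    rewrite tpermL /M /N /block_mx col_mxEd col_mxEu !mxE.
    by case: (split l) => l'; rewrite !mxE x0 // subnn npaths0 eqxx (ord1 l').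
  rewrite tpermD ?eq_rlshift // ?eq_lshift 1?eq_sym //.
  rewrite /M /N /block_mx !col_mxEu !mxE.
  by case: (split l) => l'; rewrite !mxE ?(negbTE ki) // subnn npaths0 xi (negbTE ki).
rewrite /xrow row_permE det_mulmx det_perm odd_tperm ?eq_lrshift //= expr1 mulN1r opprK.
by rewrite det_lblock det1 mulr1.
Qed.

Lemma sweep_det_left a (x : 'I_c -> nat) :
  (a <= s.*2.-2)%N -> increasing_on predT x -> (forall i, edge a (x i)) ->
  (a = s.*2.-2 -> exists i, x i = f.+1) ->
  (ntilings n.*2 h (sweep hol a (image_of predT x) pred0))%:R =
    hole_det (\matrix_i rho_ext a (x i)).
Proof.
move=> sa; rewrite -(subKn sa).
elim: (s.*2.-2 - a)%N (leq_subr a s.*2.-2) x => [|k IH] ka x incx xin.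
  rewrite subn0 in xin * => /(_ erefl)[i0 x0].
  by rewrite (sweep_det_jump (i0 := i0)) // (hole_det_jump (i0 := i0)).
have Ek : (s.*2.-2 - k = (s.*2.-2 - k.+1).+1)%N by lia.
have {IH} := IH (ltnW ka); rewrite {}Ek.
set l := (s.*2.-2 - k.+1)%N in xin * => IH _.
have ls : (l < s.*2.-2)%N by rewrite /l; lia.
have ln : (l.+1 < n.*2)%N by move: s_bounds; lia.
apply: (@strip_determinant _ _ _ hol_range _ _ _ _
  hole_det_add hole_det_alt hole_det_ext _ _ (rho_ext l.+1)) => //.
- by move=> b; apply: rho_ext_step.
- move=> i M b _ out near Mi.
  have M0 j : M i j = 0.
    have -> : M i j = row i M 0 j by rewrite mxE.
    rewrite {}Mi rho_ext_out ?mxE //.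
      by rewrite -hol_left // xpair_eqE; lia.
    by move: near; case/orP => /hol_edge ->; rewrite ?orbT.
  rewrite /hole_det (expand_det_row _ (lshift 1 i)) big1 ?oppr0 // => j _.
  by rewrite col_mxEu M0 mul0r.
- move=> i _; rewrite hol_right //; last by apply: ltnW.
  by rewrite xpair_eqE; lia.
move=> y incy _ yin.
have yin' i : edge l.+1 (y i) by apply/hol_left_edge/yin.
(* If no path arrives at the left hole, both sides vanish: the triangle to the left of the hole has
   lost its only possible partner, and the border column is zero. *)
case: (boolP ((l.+1 == s.*2.-2) && ~~ image_of predT y f.+1)) => [/andP[/eqP El nf]|].
  rewrite (@sweep_blocked _ _ _ hol_range _ _ f.+1) //.
  - rewrite /hole_det (expand_det_col _ (rshift c ord0)) big1 ?oppr0 // => k' _.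
    case: (splitP k') => k1 Ek; last first.
      have -> : k' = rshift c k1 by apply: val_inj.
      by rewrite col_mxEd row_mxEr mxE mul0r.
    have -> : k' = lshift 1 k1 by apply: val_inj.
    rewrite col_mxEu mxE row_mxEr mxE El subnn npaths0.
    rewrite (_ : (_ == _) = false) ?mul0r //.
    apply: contraNF nf => /eqP yf; apply/existsP; exists k1; rewrite /= yf //.
  - by rewrite hol_left ?El ?xpair_eqE /edge; move: s_bounds; lia.
  - by rewrite /hol El eqxx !andbF.
rewrite negb_and negbK => nf.
rewrite -IH //; last first.
  by move=> El; case/orP: nf; [rewrite El eqxx|case/existsP => i /andP[_ /eqP]; exists i].
congr _%:R; apply: sweep_next; first exact: hol_range.
move=> b; rewrite hol_left; last by rewrite xpair_eqE; lia.
rewrite /hol ln /=; case: (eqVneq (l.+1, b) _) => [[El Eb]|]; last by rewrite andbT.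
by move: nf; rewrite El Eb eqxx /= => ->; rewrite !andbF.
Qed.

Lemma card_holey_tilings :
  #|rhombus_tilings (holey_hexagon n m s)|%:R =
  hole_det (\matrix_i rho_ext 0 (n + i)) :> rat.
Proof.
rewrite holey_hexagonE -[LHS]/((ntilings n.*2 h hol)%:R).
rewrite -(@sweep_det_left 0 (fun i => n + i)%N) //.
- congr _%:R; apply: eq_ntilings => x y q xw yh; rewrite /sweep.
  case: (posnP x) => [->|//] /=; last by rewrite andbT.
  case: q; rewrite ?andbT //; case: (boolP (hol 0 y true)) => [/hol_edge|//].
  rewrite /edge andTb => yin; apply/esym/existsP.
  have yc : (y - n < c)%N by move: yin; lia.
  by exists (Ordinal yc); rewrite /=; move: yin; lia.
- by move=> i j _ _; rewrite ltn_add2l.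
- by move=> i; have := ltn_ord i; rewrite /edge; lia.
(* Here [s = 1]: the left hole has its vertical side on the left side of the hexagon, at the middle
   edge [m], where a path starts and ends at once. *)
- move=> E0; have mc : (m < c)%N by lia.
  by exists (Ordinal mc) => /=; move: E0 s_bounds; lia.
Qed.

End HoleyHexagon.

(** * A balanced hypergeometric sum *)

Section Saalschutz.
Local Open Scope ring_scope.

Definition central q : rat := 'C(q.*2, q)%:R.

Lemma factr_neq0 k : k`!%:R != 0 :> rat.
Proof. by rewrite pnatr_eq0 -lt0n fact_gt0. Qed.

Lemma factrS k : k.+1`!%:R = (k%:R + 1) * k`!%:R :> rat.
Proof. by rewrite factS natrM natr1. Qed.

Lemma central_fact q : central q * q`!%:R ^+ 2 = (q.*2)`!%:R.
Proof.
have := @bin_fact q.*2 q; rewrite -addnn leq_addr addnK => /(_ erefl).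
by move/(congr1 (fun x => x%:R : rat)); rewrite /central -addnn !natrM expr2.
Qed.

Lemma central_neq0 q : central q != 0.
Proof. by rewrite pnatr_eq0 -lt0n bin_gt0 -addnn leq_addr. Qed.

Lemma centralS q : central q.+1 = central q * (2 * (2 * q%:R + 1)) / (q%:R + 1).
Proof.
have q0 : q%:R + 1 != 0 :> rat by rewrite natr1 pnatr_eq0.
have := central_fact q.+1; rewrite doubleS !factrS -central_fact.
rewrite -[q.*2.+1%:R]natr1 -muln2 natrM.
move: (central q.+1) (central q) (q`!%:R : rat) (factr_neq0 q) => x y z z0 H.
have z2 : (q%:R + 1) ^+ 2 * z ^+ 2 != 0 by rewrite mulf_neq0 // expf_neq0.
apply: (mulIf z2); transitivity (x * ((q%:R + 1) * z) ^+ 2); first by ring.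
by rewrite H; field.
Qed.

(* In the application, r = s - 1 and e = n - s. *)
Variables n r e : nat.
Hypothesis n_def : n = (r + e).+1.

(** Up to a factor independent of [k], this is the summand of the 3F2 at 1 with upper parameters
    [-m], [r + 1/2], [n + m + 1] and lower ones [r + 2], [n + 1/2]; the latter sum to one more than
    the former. *)
Definition saal_term m k : rat :=
  (-1) ^+ k * central (k + r) * (n + k + m)`!%:R
  / (k`!%:R * (m - k)`!%:R * (k + r).+1%:R * (n + k)`!%:R * central (n + k)).

Definition saal_value m : rat :=
  (2 * m%:R + 1) * central m * central r * r`!%:R * (e + m)`!%:R
  / ((m + r).+1`!%:R * e`!%:R * central (m + n)).

(* The certificate of the WZ method:
   saal_term (m + 1) k - wz_ratio m * saal_term m k
   = wz_mate m (k + 1) - wz_mate m k. *)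
Definition wz_ratio (m : nat) : rat :=
  (2 * m%:R + 3) * (e%:R + m%:R + 1) * (m%:R + n%:R + 1)
  / ((m%:R + 1) * (r%:R + m%:R + 2) * (2 * m%:R + 2 * n%:R + 1)).

Definition wz_mate m k : rat :=
  - (2 * m%:R + n%:R + 2) / ((m%:R + 1) * (r%:R + m%:R + 2) * (2 * m%:R + 2 * n%:R + 1))
  * (-1) ^+ k * central (k + r) * (n + k + m)`!%:R * k%:R * (2 * n%:R + 2 * k%:R - 1)
  / (k`!%:R * (m.+1 - k)`!%:R * (n + k)`!%:R * central (n + k)).

Lemma saal_valueS m : saal_value m.+1 = wz_ratio m * saal_value m.
Proof.
rewrite /saal_value /wz_ratio addnS !addSn !factrS (centralS m) (centralS (m + n)).
have := factr_neq0 (m + r); have := factr_neq0 e; have := central_neq0 (m + n).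
move: (central m) (central r) (central (m + n)) (r`!%:R : rat)
  ((e + m)`!%:R : rat) (e`!%:R : rat) ((m + r)`!%:R : rat).
move=> x1 x2 x3 x4 x5 x6 x7 h3 h6 h7.
rewrite n_def !(natrD, =^~ natr1).
have := ler0n rat m; have := ler0n rat r; have := ler0n rat e.
move: (m%:R : rat) (r%:R : rat) (e%:R : rat) => M R E E0 R0 M0.
field.
by rewrite h3 h6 h7 /=; do ![apply/andP; split]; apply: lt0r_neq0; lra.
Qed.

(** Taking [m = k + d] removes the truncated differences; the recurrences of factorials and
    [central] then leave an identity of rational functions. *)
Lemma wz_step k d : saal_term (k + d).+1 k =
  wz_ratio (k + d) * saal_term (k + d) k + (wz_mate (k + d) k.+1 - wz_mate (k + d) k).
Proof.
rewrite /saal_term /wz_ratio /wz_mate.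
have -> : ((k + d).+1 - k = d.+1)%N by lia.
have -> : (k + d - k = d)%N by lia.
have -> : ((k + d).+1 - k.+1 = d)%N by lia.
have -> : (n + k.+1 = (n + k).+1)%N by lia.
rewrite (addnS (n + k)) (addSn (n + k)) (addSn k r).
rewrite !factrS (centralS (k + r)) (centralS (n + k)) exprS.
have := factr_neq0 k; have := factr_neq0 d; have := factr_neq0 (n + k).
have := central_neq0 (n + k).
move: (central (k + r)) (central (n + k)) ((n + k + (k + d))`!%:R : rat)
  (k`!%:R : rat) (d`!%:R : rat) ((n + k)`!%:R : rat) ((-1) ^+ k : rat).
move=> x1 x2 x3 x4 x5 x6 x7 h2 h6 h5 h4.
rewrite n_def !(natrD, =^~ natr1).
have := ler0n rat k; have := ler0n rat r; have := ler0n rat e; have := ler0n rat d.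
move: (k%:R : rat) (r%:R : rat) (e%:R : rat) (d%:R : rat) => K R E D D0 E0 R0 K0.
field.
by rewrite ?h2 ?h4 ?h5 ?h6 /=; do ![apply/andP; split]; apply: lt0r_neq0; lra.
Qed.

Lemma saalschutz m : \sum_(k < m.+1) saal_term m k = saal_value m.
Proof.
elim: m => [|m IH].
  rewrite big_ord1 /saal_term /saal_value expr0 !addn0 subn0 !add0n factrS !fact0.
  have -> : central 0 = 1 by rewrite /central double0 bin0.
  rewrite -[r.+1%:R]natr1.
  have := factr_neq0 r; have := factr_neq0 e; have := factr_neq0 n.
  have := central_neq0 n.
  move: (central n) (central r) (n`!%:R : rat) (e`!%:R : rat) (r`!%:R : rat).
  move=> x1 x2 x3 x4 x5 h1 h3 h4 h5.
  have := ler0n rat r; move: (r%:R : rat) => R R0.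
  field; rewrite h1 h3 h4 h5 /= ?andbT; apply: lt0r_neq0; lra.
rewrite saal_valueS -IH big_ord_recr /=.
have -> : \sum_(k < m.+1) saal_term m.+1 k = wz_ratio m * \sum_(k < m.+1) saal_term m k
     + \sum_(0 <= k < m.+1) (wz_mate m k.+1 - wz_mate m k).
  rewrite big_mkord mulr_sumr -big_split /=; apply: eq_bigr => k _.
  by have := wz_step k (m - k); rewrite subnKC // -ltnS ltn_ord.
(* [wz_mate m 0] vanishes by its factor [k], and [wz_mate m m.+1] cancels the extra summand
   [k = m + 1]. *)
rewrite telescope_sumr // -addrA [X in _ + X](_ : _ = 0) ?addr0 //.
rewrite {2}/wz_mate mulr0 !mul0r subr0 /wz_mate /saal_term !subnn.
rewrite fact0 (addnS (n + m.+1) m) (factrS (n + m.+1 + m)).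
have := factr_neq0 m.+1; have := factr_neq0 (n + m.+1); have := central_neq0 (n + m.+1).
move: (central (n + m.+1)) (central (m.+1 + r)) ((n + m.+1 + m)`!%:R : rat)
  (m.+1`!%:R : rat) ((n + m.+1)`!%:R : rat) ((-1) ^+ m.+1 : rat).
move=> x1 x2 x3 x4 x5 x6 h1 h5 h4.
rewrite n_def !(natrD, =^~ natr1).
have := ler0n rat m; have := ler0n rat r; have := ler0n rat e.
move: (m%:R : rat) (r%:R : rat) (e%:R : rat) => M R E E0 R0 M0.
field.
by rewrite ?h1 ?h4 ?h5 /=; do ![apply/andP; split]; apply: lt0r_neq0; lra.
Qed.

End Saalschutz.

(** * Interpolation weights *)

Section Weights.
Local Open Scope ring_scope.

Lemma prod_subr_ffact N M :
  \prod_(t < M) (N%:R - t%:R) = (N ^_ M)%:R :> rat.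
Proof.
elim: M => [|M IH]; first by rewrite big_ord0 ffactn0.
rewrite big_ord_recr /= IH ffactnSr natrM.
by have [/natrB <- //|/ffact_small ->] := leqP M N; rewrite !mul0r.
Qed.

Lemma prod_rising b M : \prod_(0 <= t < M) (b%:R + t%:R + 1) * b`!%:R = (b + M)`!%:R :> rat.
Proof.
elim: M => [|M IH]; first by rewrite big_geq // mul1r addn0.
by rewrite big_nat_recr //= mulrAC IH addnS factrS natrD mulrC.
Qed.

Lemma prod_node_diff m k : (k <= m)%N ->
  \prod_(j < m.+1 | j != k :> nat) (k%:R - j%:R)
  = (-1) ^+ (m - k) * k`!%:R * (m - k)`!%:R :> rat.
Proof.
elim: m => [|m IH].
  by rewrite leqn0 => /eqP ->; rewrite big1 ?mul1r ?mulr1 // => i; rewrite ord1.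
rewrite leq_eqVlt => /orP[/eqP ->|km].
  rewrite big_mkcond big_ord_recr /= eqxx /= mulr1 subnn expr0 mul1r mulr1.
  rewrite -ffactnn -prod_subr_ffact; apply: eq_bigr => i _.
  by rewrite ltn_eqF.
rewrite big_mkcond big_ord_recr /= -big_mkcond IH // gtn_eqF //=.
rewrite subSn // factrS exprS natrB // -natr1; ring.
Qed.

Lemma size_prod_linear (F : nat -> {poly rat}) i j :
  (forall t, size (F t) <= 2)%N ->
  (size (\prod_(i <= t < j) F t)%R <= (j - i).+1)%N.
Proof.
move=> F2; case: (leqP i j) => [ij|/ltnW ij]; last by rewrite big_geq // size_poly1.
elim: j ij => [|j IH]; first by rewrite leqn0 => /eqP ->; rewrite big_geq // size_poly1.
rewrite leq_eqVlt => /orP[/eqP ->|ij]; first by rewrite big_geq // size_poly1.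
rewrite big_nat_recr //= (leq_trans (size_polyMleq _ _)) //.
have := F2 j; have := IH ij; rewrite subSn //.
by move: (size _) (size _) => u v; lia.
Qed.

Variables m n e : nat.

(* central (b + l) is moment_scale b times the value at b of a polynomial of
   degree m, for all l <= m, so that Lagrange interpolation from the nodes
   n, ..., n + m to e yields the weights. *)
Definition moment_scale b : rat := central b / \prod_(0 <= t < m) (b%:R + t%:R + 1).

Definition moment_poly l : {poly rat} :=
  (\prod_(0 <= t < l) (4%:P * 'X + (4 * t%:R + 2)%:P)) *
  \prod_(l <= t < m) ('X + (t%:R + 1)%:P).

Lemma prod_rising_neq0 b i j : \prod_(i <= t < j) (b%:R + t%:R + 1) != 0 :> rat.
Proof.
apply: (big_ind (fun x => x != 0)) => // [x y|t _]; first exact: mulf_neq0.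
apply: lt0r_neq0; have := ler0n rat b; have := ler0n rat t.
lra.
Qed.

Lemma moment_scale_neq0 b : moment_scale b != 0.
Proof. by rewrite mulf_neq0 ?invr_eq0 ?central_neq0 ?prod_rising_neq0. Qed.

Lemma moment_scaleE b : moment_scale b = central b * b`!%:R / (b + m)`!%:R.
Proof.
rewrite /moment_scale -prod_rising; have := prod_rising_neq0 b 0 m; have := factr_neq0 b.
by move: (\prod_(_ <= _ < _) _) (b`!%:R : rat) => x y x0 y0; field; rewrite x0.
Qed.

Lemma horner_moment_poly l x : (moment_poly l).[x] =
  \prod_(0 <= t < l) (4 * x + (4 * t%:R + 2)) * \prod_(l <= t < m) (x + t%:R + 1).
Proof.
by rewrite hornerM !horner_prod; congr (_ * _); apply: eq_bigr => t _;
  rewrite !hornerE ?addrA.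
Qed.

(** By [centralS], going from [b] to [b + l] multiplies by the quotients
    [(4b + 4t + 2) / (b + t + 1)] for [t < l]; the scale completes the denominator to [m]
    factors. *)
Lemma central_moment b l : (l <= m)%N ->
  central (b + l) = moment_scale b * (moment_poly l).[b%:R].
Proof.
move=> lm; rewrite /moment_scale horner_moment_poly (big_cat_nat (leq0n l) lm) /=.
have := prod_rising_neq0 b l m; have := prod_rising_neq0 b 0 l.
move: (\prod_(l <= i < m) (_ + _ + _)) => y.
suff H : central (b + l) * (\prod_(0 <= t < l) (b%:R + t%:R + 1)) =
   central b * \prod_(0 <= t < l) (4 * b%:R + (4 * t%:R + 2)).
  move=> x0 y0; by rewrite (canRL (mulfK x0) H); field; rewrite x0 y0.
elim: l {lm} => [|l IH]; first by rewrite !big_geq // addn0.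
rewrite !big_nat_recr //= [in RHS]mulrA -IH addnS centralS natrD.
have : (b%:R + l%:R + 1 != 0 :> rat) by have := prod_rising_neq0 b l l.+1; rewrite big_nat1.
by move=> h; field.
Qed.

Lemma size_moment_poly l : (l <= m)%N -> (size (moment_poly l) <= m.+1)%N.
Proof.
move=> lm.
have size_lin (a c : rat) : (size (a%:P * 'X + c%:P)%R <= 2)%N.
  rewrite (leq_trans (size_polyD _ _)) // geq_max mul_polyC.
  by rewrite (leq_trans (size_scale_leq _ _)) ?size_polyX // (leq_trans (size_polyC_leq1 _)).
have sX (t : nat) : (size ('X + (t%:R + 1)%:P : {poly rat})%R <= 2)%N.
  by have := size_lin 1 (t%:R + 1); rewrite mul1r.
have H1 := size_prod_linear l m sX.
have H2 := size_prod_linear 0 l (fun t => size_lin 4 (4 * t%:R + 2)).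
rewrite (leq_trans (size_polyMleq _ _)) //; move: H1 H2.
by move: (size _) (size _) => *; lia.
Qed.

Definition node k : rat := (n + k)%:R.

Lemma node_inj : injective node.
Proof. by move=> i j /eqP; rewrite /node eqr_nat eqn_add2l => /eqP. Qed.

Definition weight (k : 'I_m.+1) : rat :=
  moment_scale e / moment_scale (n + k) *
  (tnth (@lagrange _ m.+1 node) k : {poly rat}).[e%:R].

(** [moment_poly l] has degree at most [m], so interpolation at [m + 1] nodes reproduces it. *)
Lemma sum_weight_moment l : (l <= m)%N ->
  \sum_k weight k * central (n + k + l) = central (e + l).
Proof.
move=> lm; rewrite central_moment //.
rewrite [moment_poly l](lagrange_gen (ltn0Sn m) node_inj (size_moment_poly lm)) horner_sum mulr_sumr.
apply: eq_bigr => k _; rewrite central_moment // /weight mul_polyC hornerZ /node.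
by have := moment_scale_neq0 (n + k) => h; field.
Qed.

Variable r : nat.
Hypothesis n_def : n = (r + e).+1.

Lemma weightE (k : 'I_m.+1) : weight k =
  moment_scale e / moment_scale (n + k) * ((-1) ^+ k * (r + m).+1`!%:R /
  (r`!%:R * (k + r).+1%:R * k`!%:R * (m - k)`!%:R)).
Proof.
rewrite /weight; congr (_ * _); rewrite lagrangeE // ?node_inj; last exact: node_inj.
rewrite hornerM hornerC !horner_prod.
have km : (k <= m)%N by rewrite -ltnS.
have nodesE (x : rat) : \prod_(i < m.+1 | i != k) ('X - (node i)%:P).[x] =
    \prod_(i < m.+1 | i != k) (x - node i).
  by apply: eq_bigr => i _; rewrite hornerXsubC.
rewrite !nodesE.
have -> : \prod_(i < m.+1 | i != k) (node k - node i)
    = (-1) ^+ (m - k) * k`!%:R * (m - k)`!%:R :> rat.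
  rewrite -prod_node_diff //; apply: eq_big => [i|i _]; first by rewrite -val_eqE.
  by rewrite /node !natrD; ring.
(* Since [e - (n + i) = - (r + i + 1)], restoring the missing factor [i = k] completes the product
   to a quotient of factorials. *)
have E : - (k + r).+1%:R * \prod_(i < m.+1 | i != k) (e%:R - node i) =
    (-1) ^+ m.+1 * (r + m).+1`!%:R / r`!%:R :> rat.
  have <- : - (k + r).+1%:R * \prod_(i < m.+1 | i != k) - (r%:R + i%:R + 1) =
      - (k + r).+1%:R * \prod_(i < m.+1 | i != k) (e%:R - node i) :> rat.
    congr (_ * _); apply: eq_bigr => i _.
    by rewrite /node n_def !(natrD, =^~ natr1); ring.
  rewrite -(addnS r m) -prod_rising mulrA mulfK ?factr_neq0 // big_mkord.
  transitivity (\prod_(i < m.+1) - (r%:R + i%:R + 1) : rat); last by rewrite prodrN card_ord.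
  rewrite [RHS](bigD1 k) //=; congr (_ * _).
  by rewrite !(natrD, =^~ natr1); ring.
have K0 : - (k + r).+1%:R != 0 :> rat by rewrite oppr_eq0 pnatr_eq0.
apply: (mulfI K0); rewrite mulrCA E exprS -[in (-1) ^+ m](subnK km) exprD.
move: K0; rewrite oppr_eq0; have := factr_neq0 r; have := factr_neq0 k.
have := factr_neq0 (m - k); have : (-1) ^+ (m - k) != 0 :> rat by rewrite signr_eq0.
move: ((-1) ^+ (m - k) : rat) ((m - k)`!%:R : rat) (k`!%:R : rat) (r`!%:R : rat) ((k + r).+1%:R : rat).
by move=> x1 x2 x3 x4 x5 h1 h2 h3 h4 h5; field; rewrite h1 h2 h3 h4 h5.
Qed.

Lemma sum_weight_central :
  \sum_k weight k * central (k + r) =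
  (2 * m%:R + 1) * central m * central e * central r / central (m + n).
Proof.
transitivity (moment_scale e * (r + m).+1`!%:R / r`!%:R * saal_value n r e m).
  rewrite -saalschutz // mulr_sumr; apply: eq_bigr => k _.
  rewrite weightE moment_scaleE (moment_scaleE (n + k)) /saal_term.
  have := factr_neq0 (e + m); have := factr_neq0 (n + k + m); have := factr_neq0 (n + k).
  have := central_neq0 (n + k); have := factr_neq0 r; have := factr_neq0 k.
  have := factr_neq0 (m - k); have : (k + r).+1%:R != 0 :> rat by rewrite pnatr_eq0.
  move: ((-1) ^+ k : rat) ((m - k)`!%:R : rat) (k`!%:R : rat) (r`!%:R : rat) ((k + r).+1%:R : rat)
    ((n + k + m)`!%:R : rat) ((n + k)`!%:R : rat) ((e + m)`!%:R : rat) (central (n + k)).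
  move=> x1 x2 x3 x4 x5 x6 x7 x8 x9 h5 h2 h3 h4 h9 h7 h6 h8.
  by field; rewrite ?h2 ?h3 ?h4 ?h5 ?h6 ?h7 ?h8 ?h9.
rewrite moment_scaleE /saal_value (addnC m r).
have := factr_neq0 (e + m); have := factr_neq0 (r + m).+1; have := factr_neq0 r.
have := factr_neq0 e; have := central_neq0 (m + n).
move: (central (m + n)) (e`!%:R : rat) (r`!%:R : rat) ((r + m).+1`!%:R : rat) ((e + m)`!%:R : rat).
by move=> x1 x2 x3 x4 x5 h1 h2 h3 h4 h5; field; rewrite ?h1 ?h2 ?h3 ?h4 ?h5.
Qed.

End Weights.

(** * Evaluation of the determinants *)

Section BinomialDeterminant.
Local Open Scope ring_scope.

Lemma coef_exp1X D k : ((1 + 'X) ^+ D : {poly rat})`_k = 'C(D, k)%:R.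
Proof.
elim: D k => [|D IH] k; first by rewrite expr0 coef1 bin0n.
rewrite exprS mulrDl mul1r coefD coefXM !IH.
by case: k => [|k]; rewrite ?bin0 ?addr0 // binS natrD.
Qed.

Lemma npathsE D j b : npaths D j b = if (j <= b)%N then 'C(D, b - j)%:R else 0.
Proof. by rewrite /npaths coefMXn ltnNge; case: leqP => //; rewrite coef_exp1X. Qed.

Lemma det_horner k (q : 'I_k -> {poly rat}) (x : 'rV[rat]_k) :
  (forall i, size (q i) <= k)%N ->
  \det (\matrix_(i, j) (q i).[x 0 j]) =
  \det (\matrix_(i, l < k) (q i)`_l) * \det (Vandermonde k x).
Proof.
move=> qk; rewrite -det_mulmx; congr (\det _); apply/matrixP => i j.
rewrite !mxE (horner_coef_wide _ (qk i)); apply: eq_bigr => l _; by rewrite !mxE.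
Qed.

(** Both sides share the coefficient matrix, and a Vandermonde determinant depends only on the
    differences of its nodes. *)
Lemma det_horner_shift k (q : 'I_k -> {poly rat}) a :
  (forall i, size (q i) <= k)%N ->
  \det (\matrix_(i, j < k) (q i).[j%:R]) = \det (\matrix_(i, j < k) (q i).[j%:R - a]).
Proof.
move=> qk.
have H x := det_horner (\row_j x j) qk.
have -> : (\matrix_(i, j < k) (q i).[j%:R]) = \matrix_(i, j) (q i).[(\row_(j < k) j%:R : 'rV_k) 0 j].
  by apply/matrixP => i j; rewrite !mxE.
have -> : (\matrix_(i, j < k) (q i).[j%:R - a]) = \matrix_(i, j) (q i).[(\row_(j < k) (j%:R - a) : 'rV_k) 0 j].
  by apply/matrixP => i j; rewrite !mxE.
rewrite !H !det_Vandermonde; congr (_ * _).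
apply: eq_bigr => i _; apply: eq_bigr => j _; rewrite !mxE; ring.
Qed.

Variables n c : nat.

(* Up to factors depending only on j, 'C(2n, n + i - j) is the value at j of
   row_poly i. Its values at j - n form a triangular matrix, and by the
   Vandermonde determinant the shift by n does not matter. *)
Definition row_poly i : {poly rat} :=
  \prod_(t < c.-1 - i) ((n + c.-1)%:R%:P - t%:R%:P - 'X) *
  \prod_(t < i) (n%:R%:P - t%:R%:P + 'X).

Lemma size_row_poly (i : 'I_c) : (size (row_poly i) <= c)%N.
Proof.
have s1 (a b : rat) : (size (a%:P - b%:P + 'X)%R <= 2)%N.
  rewrite -polyCB (leq_trans (size_polyD _ _)) // geq_max size_polyX.
  by rewrite (leq_trans (size_polyC_leq1 _)).
have s2 (a b : rat) : (size (a%:P - b%:P - 'X)%R <= 2)%N.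
  rewrite -polyCB (leq_trans (size_polyD _ _)) // geq_max size_polyN size_polyX.
  by rewrite (leq_trans (size_polyC_leq1 _)).
have H1 := size_prod_linear 0 (c.-1 - i) (fun t => s2 (n + c.-1)%:R t%:R).
have H2 := size_prod_linear 0 i (fun t => s1 n%:R t%:R).
rewrite !big_mkord !subn0 in H1 H2.
rewrite (leq_trans (size_polyMleq _ _)) //; move: H1 H2 (ltn_ord i).
by move: (size _) (size _) => u v; lia.
Qed.

Lemma horner_row_poly i (x : rat) : (row_poly i).[x] =
  \prod_(t < c.-1 - i) ((n + c.-1)%:R - x - t%:R) * \prod_(t < i) (n%:R + x - t%:R).
Proof.
rewrite hornerM !horner_prod; congr (_ * _); apply: eq_bigr => t _; rewrite !hornerE; ring.
Qed.

Lemma row_poly_nat i (j : 'I_c) : (row_poly i).[j%:R] =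
  ((n + c.-1 - j) ^_ (c.-1 - i) * (n + j) ^_ i)%:R.
Proof.
rewrite horner_row_poly natrM -!prod_subr_ffact natrB ?natrD //.
by have := ltn_ord j; lia.
Qed.

(** The factor [j ^_ i] vanishes for [j < i], which makes the shifted matrix triangular. *)
Lemma row_poly_shift i (j : 'I_c) : (row_poly i).[j%:R - n%:R] =
  ((n.*2 + c.-1 - j) ^_ (c.-1 - i) * j ^_ i)%:R.
Proof.
rewrite horner_row_poly natrM -!prod_subr_ffact natrB; last by have := ltn_ord j; lia.
congr (_ * _); apply: eq_bigr => t _; rewrite -?addnn ?natrD; ring.
Qed.

Lemma npaths_row_poly (i j : 'I_c) : npaths n.*2 j (n + i) =
  (n.*2)`!%:R / ((n + c.-1 - j)`!%:R * (n + j)`!%:R) * (row_poly i).[j%:R].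
Proof.
rewrite row_poly_nat npathsE natrM.
have ic := ltn_ord i; have jc := ltn_ord j.
case: leqP => ji; last by rewrite (@ffact_small (n + c.-1 - j)) ?mul0r ?mulr0 //; lia.
case: (leqP i (n + j)) => ij; last first.
  by rewrite bin_small ?(@ffact_small (n + j) i) ?mulr0 //; lia.
have H1 := @ffact_fact (n + c.-1 - j) (c.-1 - i) ltac:(lia).
have H2 := @ffact_fact (n + j) i ij.
have H3 := @bin_fact n.*2 (n + i - j) ltac:(lia).
have E1 : (n + c.-1 - j - (c.-1 - i) = n + i - j)%N by lia.
have E2 : (n.*2 - (n + i - j) = n + j - i)%N by lia.
rewrite -H1 -H2 -H3 E1 E2 !natrM.
have f1 := factr_neq0 (n + i - j); have f2 := factr_neq0 (n + j - i).
have g1 : ((n + c.-1 - j) ^_ (c.-1 - i))%:R != 0 :> rat.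
  by rewrite pnatr_eq0 -lt0n ffact_gt0; lia.
have g2 : ((n + j) ^_ i)%:R != 0 :> rat by rewrite pnatr_eq0 -lt0n ffact_gt0.
move: f1 f2 g1 g2.
move: (_`!%:R : rat) (_`!%:R : rat) (_ ^_ _)%:R (_ ^_ _)%:R 'C(_, _)%:R.
move=> x1 x2 x3 x4 x5 h1 h2 h3 h4.
by field; rewrite ?h1 ?h2 ?h3 ?h4.
Qed.

Lemma det_npaths :
  \det (\matrix_(i < c, j < c) npaths n.*2 j (n + i)) =
  \prod_(l < c) ((n.*2 + l)`!%:R * l`!%:R / (n + l)`!%:R ^+ 2).
Proof.
have -> : (\matrix_(i < c, j < c) npaths n.*2 j (n + i)) =
   (\matrix_(i < c, j < c) (row_poly i).[j%:R]) *m
   diag_mx (\row_(j < c) ((n.*2)`!%:R / ((n + c.-1 - j)`!%:R * (n + j)`!%:R))).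
  by apply/matrixP => i j; rewrite mul_mx_diag !mxE npaths_row_poly mulrC.
rewrite det_mulmx det_diag (det_horner_shift n%:R size_row_poly).
rewrite -det_tr det_trig; last first.
  apply/is_trig_mxP => i j ij; rewrite !mxE row_poly_shift.
  by rewrite [X in (_ * X)%N]ffact_small ?muln0.
rewrite -big_split /=.
under eq_bigr => i _ do rewrite !mxE row_poly_shift ffactnn.
pose a i : rat := (n.*2 + (c.-1 - i))`!%:R * i`!%:R / (n + i)`!%:R / (n + (c.-1 - i))`!%:R.
transitivity (\prod_(i < c) a i).
  apply: eq_bigr => i _; rewrite /a; have ic := ltn_ord i.
  have H1 := @ffact_fact (n.*2 + c.-1 - i) (c.-1 - i) ltac:(lia).
  have E1 : (n.*2 + c.-1 - i - (c.-1 - i) = n.*2)%N by lia.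
  have E2 : (n.*2 + (c.-1 - i) = n.*2 + c.-1 - i)%N by lia.
  have E3 : (n + (c.-1 - i) = n + c.-1 - i)%N by lia.
  rewrite E2 E3 -H1 E1 !natrM.
  have := factr_neq0 (n + i); have := factr_neq0 (n + c.-1 - i).
  move: (n + i)`!%:R (n + c.-1 - i)`!%:R (_ ^_ _)%:R (i`!%:R) (n.*2`!%:R) => x1 x2 x3 x4 x5 h2 h1.
  by field; rewrite ?h1 ?h2.
(* [a i] mixes the indices [i] and [c.-1 - i]; reversing the order of the factors [G] aligns
   them. *)
pose F i : rat := i`!%:R / (n + i)`!%:R; pose G l : rat := (n.*2 + l)`!%:R / (n + l)`!%:R.
transitivity (\prod_(i < c) (F i * G i)); last first.
  by apply: eq_bigr => i _; rewrite /F /G; have := factr_neq0 (n + i) => h; field.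
rewrite [RHS]big_split /=.
have -> : \prod_(i < c) G i = \prod_(i < c) G (c.-1 - i)%N.
  by rewrite (reindex_inj rev_ord_inj) /=; apply: eq_bigr => i _; congr G; lia.
rewrite -big_split /=; apply: eq_bigr => i _; rewrite /a /F /G.
have := factr_neq0 (n + i); have := factr_neq0 (n + (c.-1 - i)).
by move=> h1 h2; field; rewrite h1 h2.
Qed.

(** For fixed [k = l + 1] the product over [j] telescopes to [(i + l + n) / (i + l)], and the one
    over [i] is then a quotient of factorials. As the indices start at 1, no difference is
    truncated. *)
Lemma prod_boxes :
  \prod_(1 <= i < n.+1) \prod_(1 <= j < n.+1) \prod_(1 <= k < c.+1)
    ((i + j + k - 1)%N%:R / (i + j + k - 2)%N%:R) =
  \prod_(l < c) ((n.*2 + l)`!%:R * l`!%:R / (n + l)`!%:R ^+ 2) :> rat.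
Proof.
under eq_bigr => i _ do rewrite exchange_big.
rewrite exchange_big big_add1 big_mkord; apply: eq_bigr => l _.
have row i : (0 < i)%N ->
    \prod_(1 <= j < n.+1) ((i + j + l.+1 - 1)%N%:R / (i + j + l.+1 - 2)%N%:R)
    = (i + l + n)%N%:R / (i + l)%N%:R :> rat.
  move=> i0; elim: n => [|p IH].
    by rewrite big_geq // addn0 divff // pnatr_eq0; lia.
  rewrite big_nat_recr //= IH.
  have -> : (i + p.+1 + l.+1 - 1 = i + l + p.+1)%N by lia.
  have -> : (i + p.+1 + l.+1 - 2 = i + l + p)%N by lia.
  have h1 : (i + l)%:R != 0 :> rat by rewrite pnatr_eq0; lia.
  have h2 : (i + l + p)%:R != 0 :> rat by rewrite pnatr_eq0; lia.
  move: h1 h2; move: ((i + l)%:R : rat) ((i + l + p)%:R : rat) ((i + l + p.+1)%:R : rat).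
  by move=> x y z h1 h2; field; rewrite h1 h2.
rewrite (eq_big_nat _ _ (F2 := fun i => (i + l + n)%N%:R / (i + l)%N%:R)); last first.
  by move=> i /andP[i0 _]; rewrite row.
have rise M b : \prod_(1 <= i < M.+1) (i + b)%N%:R = (M + b)`!%:R / b`!%:R :> rat.
  rewrite addnC -prod_rising mulfK ?factr_neq0 // big_add1 /=.
  by apply: eq_bigr => i _; rewrite natrD -natr1; ring.
rewrite big_split /= prodfV; under eq_bigr do rewrite -addnA.
rewrite !rise (_ : n + (l + n) = n.*2 + l)%N; last by lia.
rewrite (addnC l n); have := factr_neq0 (n + l); have := factr_neq0 l.
move: (l`!%:R : rat) ((n + l)`!%:R : rat) ((n.*2 + l)`!%:R : rat) => x y z x0 y0.
by field; rewrite x0 y0.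
Qed.

End BinomialDeterminant.

(** * The determinant bordered by one row and one column *)

Section BorderedDeterminant.
Local Open Scope ring_scope.

(** Subtracting [w] times the upper rows from the last one clears [v] and leaves [- (w *m u)] in the
    corner. *)
Lemma det_bordered k (M : 'M[rat]_k) (u : 'cV_k) (v w : 'rV_k) :
  w *m M = v -> - \det (block_mx M u v 0) = \det M * (w *m u) 0 0.
Proof.
move=> wM.
have E : block_mx 1%:M 0 (- w) 1%:M *m block_mx M u v 0 = block_mx M u 0 (- (w *m u)).
  by rewrite mulmx_block !mul1mx !mul0mx !addr0 !mulNmx wM addNr.
have := congr1 determinant E.
rewrite det_mulmx det_lblock !det1 !mul1r => ->.
by rewrite det_ublock det_mx11 mxE mulrN opprK.
Qed.

Definition bin_from_middle q t : rat := 'C(q.*2, q + t)%:R.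

Lemma bin_from_middle0 q : bin_from_middle q 0 = central q.
Proof. by rewrite /bin_from_middle addn0. Qed.

Lemma bin_from_middleS q t : bin_from_middle q.+1 t.+1 =
  bin_from_middle q t.+2 + 2 * bin_from_middle q t.+1 + bin_from_middle q t.
Proof.
rewrite /bin_from_middle doubleS !addnS addSn !binS !natrD; ring.
Qed.

Lemma bin_from_middleS0 q : bin_from_middle q.+1 0 =
  2 * (bin_from_middle q 1 + bin_from_middle q 0).
Proof.
rewrite /bin_from_middle doubleS !addnS !addn0.
rewrite binS -[X in (_ + X)%N](@bin_sub _ q); last by lia.
have -> : (q.*2.+1 - q = q.+1)%N by lia.
rewrite binS !natrD; ring.
Qed.

(** The sum of the two truncated differences is the absolute value of [b - (q + j)]. *)
Lemma npaths_from_middle q j b :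
  npaths q.*2 j b = bin_from_middle q ((b - (q + j)) + ((q + j) - b)).
Proof.
rewrite npathsE /bin_from_middle; case: leqP => jb; last by rewrite bin_small //; lia.
case: (leqP (q + j) b) => qj; first by congr ('C(_, _)%:R); lia.
case: (leqP (b - j) q.*2) => H; last by lia.
by rewrite -(bin_sub H); congr ('C(_, _)%:R); lia.
Qed.

Variables m n r e : nat.
Hypothesis n_def : n = (r + e).+1.
Local Notation weight := (weight n e).

(** Pascal's rule applied twice expresses distance [t + 2] from the middle through smaller distances
    at [q] and [q + 1]. Each unit of distance thus uses one more moment, whence the bound on
    [t + l]. *)
Lemma sum_weight_bin t l : (t + l <= m)%N ->
  \sum_(k < m.+1) weight k * bin_from_middle (n + k + l) t = bin_from_middle (e + l) t.
Proof.
pose P t := forall l, (t + l <= m)%N ->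
  \sum_(k < m.+1) weight k * bin_from_middle (n + k + l) t = bin_from_middle (e + l) t.
suff : P t /\ P t.+1 by case=> + _; apply.
have P0 : P 0%N.
  move=> {}l lm; rewrite bin_from_middle0 -(sum_weight_moment n e lm).
  by apply: eq_bigr => k _; rewrite bin_from_middle0.
elim: t {l} => [|t [IH0 IH1]]; split => // l lm.
  have H q : bin_from_middle q 1 = 2^-1 * bin_from_middle q.+1 0 - bin_from_middle q 0.
    by rewrite bin_from_middleS0; field.
  rewrite H -addnS -(P0 l.+1); last by lia.
  rewrite -(P0 l); last by lia.
  rewrite mulr_sumr -sumrB; apply: eq_bigr => k _.
  by rewrite H addnS; ring.
have H q : bin_from_middle q t.+2 =
    bin_from_middle q.+1 t.+1 - 2 * bin_from_middle q t.+1 - bin_from_middle q t.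
  by rewrite bin_from_middleS; ring.
rewrite H -addnS -(IH1 l.+1); last by lia.
rewrite -(IH1 l); last by lia.
rewrite -(IH0 l); last by lia.
rewrite mulr_sumr -!sumrB; apply: eq_bigr => k _.
by rewrite H addnS; ring.
Qed.

(** These are the coefficients of the sum of [weight k] times [(1 + X)^(2k) X^(m - k)], each term
    being symmetric about degree [m]. *)
Definition solution i : rat := \sum_(k < m.+1) weight k * npaths k.*2 (m - k) i.

Lemma sum_solution D N :
  \sum_(i < m.*2.+1) solution i * npaths D i N =
  \sum_(k < m.+1) weight k * npaths (D + k.*2) (m - k) N.
Proof.
under eq_bigr => i _ do rewrite mulr_suml.
rewrite exchange_big; apply: eq_bigr => k _ /=.
under eq_bigr => i _ do rewrite -mulrA.
rewrite -mulr_sumr; congr (_ * _); rewrite /npaths exprD -mulrA.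
set F := ((1 + 'X) ^+ k.*2 * 'X^(m - k)).
have {2}-> : F = \poly_(i < m.*2.+1) F`_i.
  apply/polyP => i; rewrite coef_poly; case: ltnP => // mi.
  rewrite nth_default // (leq_trans _ mi) // (leq_trans (size_polyMleq _ _)) //.
  by rewrite size_exp1X size_polyXn; have := ltn_ord k; lia.
rewrite poly_def mulr_sumr coef_sum; apply: eq_bigr => i _.
by rewrite -scalerAr coefZ.
Qed.

Lemma solution_row : (\row_(i < m.*2.+1) solution i) *m
    (\matrix_(i, j < m.*2.+1) npaths n.*2 j (n + i)) =
  \row_j npaths e.*2 j (e + m).
Proof.
apply/rowP => j; rewrite !mxE.
under eq_bigr => i _.
  rewrite !mxE npaths_from_middle.
  have -> : (n + i - (n + j) + (n + j - (n + i)) = n + j - (n + i) + (n + i - (n + j)))%N by lia.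
  rewrite -npaths_from_middle.
  over.
rewrite sum_solution npaths_from_middle.
rewrite -[in RHS](addn0 e) -sum_weight_bin; last by have := ltn_ord j; lia.
apply: eq_bigr => k _; rewrite -doubleD npaths_from_middle addn0; congr (_ * bin_from_middle _ _).
by have := ltn_ord k; lia.
Qed.

Lemma solution_col : ((\row_(i < m.*2.+1) solution i) *m
    (\col_(i < m.*2.+1) npaths r.*2 (n + m - r) (n + i))) 0 0 =
  (2 * m%:R + 1) * central m * central e * central r / central (m + n).
Proof.
rewrite -(sum_weight_central m n_def) mxE.
under eq_bigr => i _.
  rewrite !mxE npaths_from_middle.
  have -> : (n + i - (r + (n + m - r)) + (r + (n + m - r) - (n + i)) =
             (r + m) - (r + i) + (r + i - (r + m)))%N by lia.
  rewrite -npaths_from_middle.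
  over.
rewrite sum_solution; apply: eq_bigr => k _; rewrite -doubleD npaths_from_middle -bin_from_middle0 addnC.
by congr (_ * bin_from_middle _ _); have := ltn_ord k; lia.
Qed.

End BorderedDeterminant.

Local Open Scope ring_scope.

Theorem theorem2 (n m s : nat) (n_ge1 : (1 <= n)%N) (s_bounds : (1 <= s <= n)%N) :
  #|rhombus_tilings (holey_hexagon n m s)|%:R =
    ((2 * m + 1)%N%:R * 'C(2 * m, m)%:R
       * 'C(2 * n - 2 * s, n - s)%:R * 'C(2 * s - 2, s - 1)%:R)
      / 'C(2 * m + 2 * n, m + n)%:R
    * \prod_(1 <= i < n.+1) \prod_(1 <= j < n.+1) \prod_(1 <= k < (2 * m + 1).+1)
        ((i + j + k - 1)%N%:R / (i + j + k - 2)%N%:R) :> rat.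
Proof.
have [r [e [n_def s_def]]] : exists r e, n = (r + e).+1 /\ s = r.+1.
  by exists s.-1, (n - s)%N; lia.
rewrite card_holey_tilings // prod_boxes.
have -> : (2 * m + 1 = m.*2.+1)%N by lia.
rewrite -det_npaths [RHS]mulrC.
have -> : hole_det n s (\matrix_i rho_ext n m s 0 (n + i)) =
  - \det (block_mx (\matrix_(i, j < m.*2.+1) npaths n.*2 j (n + i))
     (\col_(i < m.*2.+1) npaths r.*2 (n + m - r) (n + i))
     (\row_j npaths e.*2 j (e + m)) 0).
  rewrite /hole_det /block_mx; congr (- \det (col_mx _ (row_mx _ _))).
  - apply/matrixP => i j; rewrite !mxE.
    case: (split j) => k; rewrite !mxE ?subn0 // s_def.
    by congr npaths; lia.
  - by apply/rowP => j; rewrite !mxE; congr npaths; lia.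
rewrite (det_bordered _ (solution_row _ n_def)) (solution_col _ n_def).
congr (_ * _); rewrite /central.
have -> : (2 * n - 2 * s = e.*2)%N by lia.
have -> : (n - s = e)%N by lia.
have -> : (2 * s - 2 = r.*2)%N by lia.
have -> : (s - 1 = r)%N by lia.
have -> : (2 * m + 2 * n = (m + n).*2)%N by lia.
by rewrite -mul2n -[(2 * m).+1%:R]natr1 natrM.
Qed.
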